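(* Let $X$ be a compact Kähler manifold of dimension $n$, let $\Omega\in H^{n-d,n-d}(X,\mathbb{R})$ be a strictly Lorentzian class of dimension $d$ ($2\le d\le n-2$), and let $\alpha,\beta$ be nef classes on $X$ that are big on $\Omega$. Then the following are equivalent: (1) $\alpha,\beta$ are proportional; (2) for some $1\le k\le d-1$, the classes $\alpha^k$ and $\beta^k$ are proportional; (3) for some $1\le k\le d-1$, the classes $\alpha^k\cdot\Omega$ and $\beta^k\cdot\Omega$ are proportional; (4) for any $1\le k\le d-1$, $(\alpha^k\cdot\beta^{d-k}\cdot\Omega)^2=(\alpha^{k-1}\cdot\beta^{d-k+1}\cdot\Omega)(\alpha^{k+1}\cdot\beta^{d-k-1}\cdot\Omega)$; (5) $|\alpha+\beta|_\Omega^{1/d}=|\alpha|_\Omega^{1/d}+|\beta|_\Omega^{1/d}$.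
   Context: A class in $H^{1,1}(X,\mathbb{R})$ is nef if it lies in the closure of the cone $\mathrm{Amp}^1(X)$ of Kähler classes. For $d\ge2$, a class $\Omega\in H^{n-d,n-d}(X,\mathbb{R})$ is called a strictly Lorentzian class of dimension $d$ if (i) $\omega_1\cdot\ldots\cdot\omega_d\cdot\Omega>0$ for all $\omega_1,\dots,\omega_d\in \mathrm{Amp}^1(X)$, and (ii) for all $\omega_1,\dots,\omega_{d-2}\in \mathrm{Amp}^1(X)$ the bilinear form $(\xi,\eta)\mapsto\xi\cdot\eta\cdot\omega_1\cdot\ldots\cdot\omega_{d-2}\cdot\Omega$ on $H^{1,1}(X,\mathbb{R})$ has Lorentzian signature $(+,-,\dots,-)$. For a nef class $\alpha$, $|\alpha|_\Omega=\alpha^d\cdot\Omega$, and $\alpha$ is big on $\Omega$ if $|\alpha|_\Omega>0$. *)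

(* Defs.v *)
From HB Require Import structures.
From mathcomp Require Import all_boot all_order all_algebra.
From mathcomp Require Import all_classical all_reals all_analysis.
Set Implicit Arguments.
Unset Strict Implicit.
Unset Printing Implicit Defensive.
Import Order.TTheory GRing.Theory Num.Theory.
Import numFieldNormedType.Exports.
Local Open Scope classical_set_scope.
Local Open Scope ring_scope.

(* ------------------------------------------------------------------------ *)
(* The complex vector space C^n, seen as R^(2n): the row vector             *)
(* row_mx x y stands for x + i y.                                           *)

Notation Cn R n := 'rV[R]_(n + n).

Definition mulI (R : realType) (n : nat) (v : Cn R n) : Cn R n :=
  row_mx (- rsubmx v) (lsubmx v).

Definition mulC (R : realType) (n : nat) (a b : R) (v : Cn R n) : Cn R n :=
  a *: v + b *: mulI v.

(* The real basis e_1, i e_1, ..., e_n, i e_n of C^n, which is positively   *)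
(* oriented for the canonical orientation.                                  *)
Definition frame (R : realType) (n : nat) : seq (Cn R n) :=
  flatten [seq [:: (delta_mx 0 (lshift n j) : Cn R n);
                   mulI (delta_mx 0 (lshift n j))] | j <- enum 'I_n].

(* f is C^oo on the open set U: every iterated directional derivative of f  *)
(* is differentiable at every point of U.                                   *)
Definition smooth_on (R : realType) (V W : normedModType R) (U : set V)
    (f : V -> W) : Prop :=
  forall (vs : seq V) (x : V), U x ->
    differentiable (foldr (fun v (g : V -> W) => 'D_v g) f vs) x.

(* Lebesgue integral on R^N of a compactly supported continuous function,   *)
(* as an iterated integral.                                                 *)
Fixpoint iterated_integral (R : realType) (N : nat) : ('rV[R]_N -> R) -> R :=
  match N with
  | 0%N => fun f => f 0
  | N'.+1 => fun f =>
      (\int[@lebesgue_measure R]_(t in setT)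
         iterated_integral
           (fun v : 'rV[R]_N' => f (row_mx (t%:M : 'rV[R]_1) v)))%R
  end.

(* ------------------------------------------------------------------------ *)
(* A structure of complex manifold of dimension n on X, given by a          *)
(* holomorphic atlas; a smooth map is holomorphic when its differential     *)
(* commutes with multiplication by i. The values of chart i outside dom i,  *)
(* and of param i outside the image of dom i, are irrelevant.               *)
Record complex_manifold (R : realType) (n : nat) (X : topologicalType) :=
  ComplexManifold {
    idx : Type;
    dom : idx -> set X;
    chart : idx -> X -> Cn R n;
    param : idx -> Cn R n -> X;
    dom_open : forall i, open (dom i);
    dom_cover : forall x, exists i, dom i x;
    image_open : forall i, open (chart i @` dom i);
    chartK : forall i x, dom i x -> param i (chart i x) = x;
    chart_continuous : forall i x, dom i x -> {for x, continuous (chart i)};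
    param_continuous : forall i y,
      (chart i @` dom i) y -> {for y, continuous (param i)};
    transition_smooth : forall i j,
      smooth_on (chart i @` (dom i `&` dom j)) (chart j \o param i);
    transition_holomorphic : forall i j y v,
      (chart i @` (dom i `&` dom j)) y ->
      'd (chart j \o param i) y (mulI v) =
        mulI ('d (chart j \o param i) y v)
  }.

Definition chart_image (R : realType) (n : nat) (X : topologicalType)
    (M : complex_manifold R n X) (i : idx M) : set (Cn R n) :=
  chart i @` dom i.

(* ------------------------------------------------------------------------ *)
(* Differential forms. A (real) form is the family of its expressions in    *)
(* the charts: eta i y [:: v_1; ...; v_k] is the value of eta, read in the  *)
(* chart i, at the point of coordinate y, on the tangent vectors v_1, ...,  *)
(* v_k. Only the values at points y of chart_image i are meaningful; a form *)
(* of degree k vanishes on lists of length other than k.                    *)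
Definition diff_form (R : realType) (n : nat) (X : topologicalType)
    (M : complex_manifold R n X) : Type :=
  idx M -> Cn R n -> seq (Cn R n) -> R^o.

Definition alternating_map (R : realType) (V : lmodType R) (k : nat)
    (f : seq V -> R) : Prop :=
  [/\ forall s, size s <> k -> f s = 0,
      forall s1 s2 (a : R) (u v : V),
        f (s1 ++ (a *: u + v) :: s2) = a * f (s1 ++ u :: s2) + f (s1 ++ v :: s2)
    & forall s, ~~ uniq s -> f s = 0].

Definition smooth_form (R : realType) (n : nat) (X : topologicalType)
    (M : complex_manifold R n X) (k : nat) (eta : diff_form M) : Prop :=
  [/\ forall i y, chart_image i y -> alternating_map k (eta i y),
      forall i s, smooth_on (chart_image i) (fun y => eta i y s)
    & forall i j y s, (chart i @` (dom i `&` dom j)) y ->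
        eta i y s =
          eta j (chart j (param i y)) (map ('d (chart j \o param i) y) s)].

(* Number of pairs p < q with m_p = false and m_q = true: its parity is the *)
(* signature of the shuffle that moves the true positions first.            *)
Fixpoint shuffle_inv (m : seq bool) : nat :=
  if m is b :: m' then ((if b then 0 else count id m') + shuffle_inv m')%N
  else 0%N.

(* (f /\ g)(v_1, ..., v_m) is the signed sum, over the subsets S of         *)
(* {1, ..., m}, of f(v_p, p in S) g(v_q, q not in S); when f and g are      *)
(* homogeneous only the S of cardinality deg f contribute.                  *)
Definition wedge (R : realType) (n : nat) (X : topologicalType)
    (M : complex_manifold R n X) (f g : diff_form M) : diff_form M :=
  fun i y s =>
    \sum_(m : (size s).-tuple bool)
      (-1) ^+ shuffle_inv m * (f i y (mask m s) * g i y (mask (map negb m) s)).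

Definition form1 (R : realType) (n : nat) (X : topologicalType)
    (M : complex_manifold R n X) : diff_form M :=
  fun _ _ s => (nilp s)%:R.

Definition wpow (R : realType) (n : nat) (X : topologicalType)
    (M : complex_manifold R n X) (f : diff_form M) (k : nat) : diff_form M :=
  iter k (wedge f) (@form1 R n X M).

Definition wprod (R : realType) (n : nat) (X : topologicalType)
    (M : complex_manifold R n X) (ws : seq (diff_form M)) (f : diff_form M) :
    diff_form M :=
  foldr (@wedge R n X M) f ws.

Definition dform (R : realType) (n : nat) (X : topologicalType)
    (M : complex_manifold R n X) (eta : diff_form M) : diff_form M :=
  fun i y s =>
    \sum_(p < size s)
      (-1) ^+ p *
        'D_(nth 0 s p) (fun z : Cn R n => eta i z (take p s ++ drop p.+1 s)) y.

Definition closed_form (R : realType) (n : nat) (X : topologicalType)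
    (M : complex_manifold R n X) (eta : diff_form M) : Prop :=
  forall i y s, chart_image i y -> dform eta i y s = 0.

(* Equality of de Rham classes. Cohomology classes are handled through      *)
(* representatives: everything below only depends on them up to this        *)
(* relation.                                                                *)
Definition cohomologous (R : realType) (n : nat) (X : topologicalType)
    (M : complex_manifold R n X) (f g : diff_form M) : Prop :=
  exists (k : nat) (theta : diff_form M), smooth_form k theta /\
    forall i y s, chart_image i y -> f i y s - g i y s = dform theta i y s.

(* Representatives of the classes in H^{p,p}(X, R): closed real forms of    *)
(* type (p,p). Among forms of degree 2p, those of type (p,p) are            *)
(* characterized by eta(z v_1, ..., z v_2p) = z^p (conj z)^p eta(v_1, ...)  *)
(* for z = a + i b.                                                         *)
Definition Hpp (R : realType) (n : nat) (X : topologicalType)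
    (M : complex_manifold R n X) (p : nat) (eta : diff_form M) : Prop :=
  [/\ smooth_form p.*2 eta, closed_form eta
    & forall i y s (a b : R), chart_image i y ->
        eta i y (map (mulC a b) s) = (a ^+ 2 + b ^+ 2) ^+ p * eta i y s].

Definition kahler_form (R : realType) (n : nat) (X : topologicalType)
    (M : complex_manifold R n X) (w : diff_form M) : Prop :=
  Hpp 1 w /\
  forall i y (v : Cn R n), chart_image i y -> v != 0 ->
    0 < w i y [:: v; mulI v].

Definition compact_kahler (R : realType) (n : nat) (X : topologicalType)
    (M : complex_manifold R n X) : Prop :=
  [/\ compact [set: X], hausdorff_space X
    & exists w : diff_form M, kahler_form w].

(* The cone Amp^1(X) of Kaehler classes. *)
Definition ample (R : realType) (n : nat) (X : topologicalType)
    (M : complex_manifold R n X) (eta : diff_form M) : Prop :=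
  Hpp 1 eta /\ exists w : diff_form M, kahler_form w /\ cohomologous eta w.

Definition seminorm_H11 (R : realType) (n : nat) (X : topologicalType)
    (M : complex_manifold R n X) (p : diff_form M -> R) : Prop :=
  [/\ forall f g, Hpp 1 f -> Hpp 1 g -> cohomologous f g -> p f = p g,
      forall f, Hpp 1 f -> 0 <= p f,
      forall f g, Hpp 1 f -> Hpp 1 g -> p (f + g) <= p f + p g
    & forall (a : R) f, Hpp 1 f -> p (a *: f) = `|a| * p f].

(* Closure of Amp^1(X) in H^{1,1}(X, R). The topology of a real vector      *)
(* space of finite dimension is the one defined by all its seminorms (a     *)
(* single norm dominates them all).                                         *)
Definition nef (R : realType) (n : nat) (X : topologicalType)
    (M : complex_manifold R n X) (alpha : diff_form M) : Prop :=
  Hpp 1 alpha /\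
  forall (p : diff_form M -> R) (e : R), seminorm_H11 p -> 0 < e ->
    exists w : diff_form M, ample w /\ p (alpha - w) < e.

Definition proportional (R : realType) (n : nat) (X : topologicalType)
    (M : complex_manifold R n X) (f g : diff_form M) : Prop :=
  exists c : R, c != 0 /\ cohomologous f (c *: g).

(* I is the integration of cohomology classes of top degree over X, X being *)
(* oriented by its complex structure: the linear map H^{2n}(X, R) -> R      *)
(* which, on a form with compact support in the domain of a chart, is the   *)
(* Lebesgue integral of its coefficient in that chart. It is unique, by     *)
(* partitions of unity.                                                     *)
Definition integration (R : realType) (n : nat) (X : topologicalType)
    (M : complex_manifold R n X) (I : diff_form M -> R) : Prop :=
  [/\ forall f g, smooth_form n.*2 f -> smooth_form n.*2 g ->
        cohomologous f g -> I f = I g,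
      forall (a : R) f g, smooth_form n.*2 f -> smooth_form n.*2 g ->
        I (a *: f + g) = a * I f + I g
    & forall i (K : set X) f, smooth_form n.*2 f ->
        compact K -> K `<=` dom i ->
        (forall j y s, chart_image j y -> ~ K (param j y) -> f j y s = 0) ->
        I f = iterated_integral
                (fun y : Cn R n => \1_(chart_image i) y * f i y (frame R n))].

(* The bilinear form q on H^{1,1}(X, R) has signature (+,-,...,-): it is    *)
(* diagonal with such signs in some basis e_0, ..., e_m. Unique coordinates *)
(* express that (e_i) is a basis.                                           *)
Definition lorentzian_signature (R : realType) (n : nat) (X : topologicalType)
    (M : complex_manifold R n X) (q : diff_form M -> diff_form M -> R) : Prop :=
  exists (m : nat) (e : 'I_m.+1 -> diff_form M),
    [/\ forall i, Hpp 1 (e i),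
        forall f, Hpp 1 f ->
          exists! c : {ffun 'I_m.+1 -> R}, cohomologous f (\sum_i c i *: e i),
        forall i j, i != j -> q (e i) (e j) = 0,
        0 < q (e ord0) (e ord0)
      & forall i, i != ord0 -> q (e i) (e i) < 0].

Definition strictly_lorentzian (R : realType) (n : nat) (X : topologicalType)
    (M : complex_manifold R n X) (I : diff_form M -> R) (d : nat)
    (Omega : diff_form M) : Prop :=
  [/\ Hpp (n - d) Omega,
      forall ws : d.-tuple (diff_form M), (forall k, ample (tnth ws k)) ->
        0 < I (wprod ws Omega)
    & forall ws : (d - 2).-tuple (diff_form M), (forall k, ample (tnth ws k)) ->
        lorentzian_signature
          (fun xi eta => I (wedge xi (wedge eta (wprod ws Omega))))].

(* |alpha|_Omega *)
Definition vol (R : realType) (n : nat) (X : topologicalType)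
    (M : complex_manifold R n X) (I : diff_form M -> R) (d : nat)
    (Omega alpha : diff_form M) : R :=
  I (wedge (wpow alpha d) Omega).

(* alpha^j . beta^k . Omega *)
Definition mixed (R : realType) (n : nat) (X : topologicalType)
    (M : complex_manifold R n X) (I : diff_form M -> R)
    (Omega alpha beta : diff_form M) (j k : nat) : R :=
  I (wedge (wpow alpha j) (wedge (wpow beta k) Omega)).

(* Main.v *)
Require Import Defs.
From HB Require Import structures.
From mathcomp Require Import all_boot all_order all_algebra.
From mathcomp Require Import all_classical all_reals all_analysis.
From mathcomp Require Import ring lra zify.
Set Implicit Arguments.
Unset Strict Implicit.
Unset Printing Implicit Defensive.
Import Order.TTheory GRing.Theory Num.Theory.
Import numFieldNormedType.Exports.
Local Open Scope classical_set_scope.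
Local Open Scope ring_scope.

(* Everything reduces to the symmetric multilinear form
   F(x_1, ..., x_d) = x_1 ... x_d . Omega on H^{1,1}, which satisfies the
   reverse Cauchy-Schwarz inequality in two slots when the others are ample,
   hence also when they are nef.

   Positivity: the inequality F(x,x,s) F(y,z,s) <= 2 F(x,y,s) F(x,z,s) iterates
   to F(x^d) F(y,s) <= 2^(d-1) F(y,x^(d-1)) F(x,s); hence replacing a nef class
   by an ample one, and then by a nef and big one, keeps intersection numbers
   positive. So a_j = alpha^j beta^(d-j) Omega is a positive log-concave
   sequence, and (3), (4), (5) each force it to be geometric.

   From (5) to (1): if a_j = s^j t^(d-j), put u = t alpha - s beta. By induction
   on m, F(u, w_1, ..., w_m, alpha^i, beta^j) = 0 for ample w_k: the form
   F(., ., w_1, ..., w_m, alpha^i, beta^j) is positive on alpha and vanishes at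
   (u, alpha) and (u, u), so u lies in its kernel. For m = d - 2 the form is
   nondegenerate, whence u = 0. *)

(** * Log-concave sequences *)

Section RealInequalities.
Variable R : realFieldType.
Implicit Types a b c e m : R.

Lemma affine_bounded_slope0 a b c : (forall t, a + t * b <= c) -> b = 0.
Proof.
move=> h; apply/eqP/negPn/negP => b0.
have := h ((c - a + 1) / b); rewrite divfK //; lra.
Qed.

(** Taking [p = c] and [q = b] turns the right side into [(2bc)^2], and dividing by [2bc] gives the
    bound. If [b] or [c] vanishes, a large coefficient in front of it contradicts [m > 0]. *)
Lemma le_double_mul m b c : 0 <= b -> 0 <= c ->
  (forall p q, p * q * m *+ 2 <= (p * b + q * c) ^+ 2) -> m <= b * c *+ 2.
Proof.
move=> b0 c0 h; have [m0|m0] := leP m 0; first by nra.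
have [b1|b1] := eqVneq b 0.
  have := h ((c ^+ 2 + 1) / m) 1; rewrite b1 mulr1 divfK ?gt_eqF //.
  nra.
have [c1|c1] := eqVneq c 0.
  have := h 1 ((b ^+ 2 + 1) / m); rewrite c1 mul1r divfK ?gt_eqF //.
  nra.
have bc0 : 0 < b * c by rewrite mulr_gt0 // lt_neqAle eq_sym ?b1 ?c1.
have := h c b; rewrite [c * b]mulrC => hh.
rewrite -(ler_pM2l bc0); nra.
Qed.

Lemma le_sqr_of_approx a b c : 0 < b ->
  (forall e, 0 < e -> exists a' b' c', [/\ `|a - a'| < e, `|b - b'| < e,
     `|c - c'| < e & 0 < b' -> a' * b' <= c' ^+ 2]) -> a * b <= c ^+ 2.
Proof.
move=> b0 h; rewrite leNgt; apply/negP => lt.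
(* The total error stays below [e * k]: the linear terms contribute [|a| + b + 2|c|] and, since
   [e <= 1], the two quadratic ones at most 2. The bound [e <= b] keeps [b'] positive. *)
pose k := `|a| + b + `|c| *+ 2 + 3%:R.
have a_ge := normr_ge0 a; have c_ge := normr_ge0 c.
have k0 : 0 < k by rewrite /k; lra.
pose e := Num.min (Num.min 1 b) ((a * b - c ^+ 2) / k).
have e0 : 0 < e.
  by rewrite !lt_min ltr01 b0 divr_gt0 // subr_gt0.
have [a' [b' [c' [ha hb hc h']]]] := h e e0.
have e1 : e <= 1 by rewrite !ge_min lexx.
have eb : e <= b by rewrite !ge_min lexx orbT.
have ek : e * k <= a * b - c ^+ 2.
  by rewrite -ler_pdivlMr // !ge_min lexx orbT.
have {}h' : a' * b' <= c' ^+ 2.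
  by apply: h'; move: hb; rewrite ltr_norml => /andP[]; lra.
set x := a - a' in ha; set y := b - b' in hb; set z := c - c' in hc.
have Ex : a' = a - x by rewrite /x; ring.
have Ey : b' = b - y by rewrite /y; ring.
have Ez : c' = c - z by rewrite /z; ring.
have hab : a * b - c ^+ 2 <= x * b + a * y - x * y - c * z *+ 2 + z ^+ 2.
  by move: h'; rewrite Ex Ey Ez; lra.
have b1 : x * b < e * b.
  by rewrite ltr_pM2r //; move: ha; rewrite ltr_norml => /andP[].
have b2 : a * y <= `|a| * e.
  by apply: le_trans (ler_norm _) _; rewrite normrM ler_wpM2l // ltW.
have b3 : - (x * y) <= e * e.
  by apply: le_trans (ler_norm _) _; rewrite normrN normrM ler_pM // ltW.
have b4 : - (c * z) <= `|c| * e.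
  by apply: le_trans (ler_norm _) _; rewrite normrN normrM ler_wpM2l // ltW.
have b5 : z ^+ 2 <= e * e.
  by apply: le_trans (ler_norm _) _; rewrite expr2 normrM ler_pM // ltW.
have b6 : e * e <= e by rewrite -[leRHS]mulr1 ler_wpM2l // ltW.
by move: ek; rewrite /k; lra.
Qed.

End RealInequalities.

Section LogConcave.
Variables (R : realFieldType) (d : nat) (a : nat -> R).
Hypothesis a_gt0 : forall j, (j <= d)%N -> 0 < a j.

Section Concave.
Hypothesis a_concave : forall j, (j.+2 <= d)%N -> a j * a j.+2 <= a j.+1 ^+ 2.

(** Log-concavity is the monotonicity of these ratios; the two results below argue on them. *)
Let r j := a j.+1 / a j.

Let r_noninc i j : (i <= j)%N -> (j.+1 <= d)%N -> r j <= r i.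
Proof.
move=> ij jd; rewrite -(subnKC ij) in jd *; elim: (j - i)%N jd => [|m IH] jd.
  by rewrite addn0.
rewrite addnS in jd *.
have jd' : ((i + m).+1 <= d)%N by rewrite ltnW.
apply: le_trans (IH jd').
have [a0 a1] : 0 < a (i + m)%N /\ 0 < a (i + m).+1 by rewrite !a_gt0; lia.
by rewrite /r ler_pdivrMr // mulrAC ler_pdivlMr // mulrC -expr2 a_concave.
Qed.

(** Periodicity up to the factor [c] gives [r (k + i) = r i], and a monotone sequence with equal
    values at both ends of a window is constant on it. *)
Lemma periodic_log_concave (k : nat) (c : R) : (1 <= k <= d - 1)%N ->
  (forall i, (i <= d - k)%N -> a (k + i)%N = c * a i) ->
  forall j, (j.+2 <= d)%N -> a j.+1 ^+ 2 = a j * a j.+2.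
Proof.
move=> /andP[k0 kd] per j jd.
have c0 : c != 0.
  apply/eqP => c0; have := a_gt0 (j := k); rewrite -[k]addn0 per // c0 mul0r ltxx.
  by move=> /(_ _)/negP; rewrite addn0; case/(_ _); lia.
(* The window from [i] to [k + i] contains both [j] and [j.+1]; the cap [d - 1 - k] keeps the ratio
   at [k + i] within range. *)
pose i := minn j (d - 1 - k).
have rik : r (k + i)%N = r i.
  rewrite /r -addnS !per; [|rewrite /i; lia..].
  by rewrite invfM mulrACA divff // mul1r.
have rj : r j.+1 = r j.
  apply/eqP; rewrite eq_le r_noninc //=.
  have := @r_noninc i j; have := @r_noninc j.+1 (k + i)%N.
  rewrite rik => /(_ _ _)h1 /(_ _ _)h2.
  by apply: le_trans (h2 _ _) (h1 _ _); rewrite /i; lia.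
have [a0 a1] : a j != 0 /\ a j.+1 != 0 by rewrite !gt_eqF ?a_gt0 //; lia.
move/eqP: rj; rewrite /r eqr_div // => /eqP h.
by rewrite expr2 -h mulrC.
Qed.

(** A concave function lies above its chord, here in multiplicative form: the geometric sequence
    agrees with [a] at both ends. *)
Lemma log_concave_ge_geometric (s t : R) : 0 < s -> 0 < t ->
  s ^+ d = a d -> t ^+ d = a 0 ->
  forall j, (j <= d)%N -> s ^+ j * t ^+ (d - j) <= a j.
Proof.
move=> s0 t0 sd td.
pose u j := s ^+ j * t ^+ (d - j).
have u0 j : 0 < u j by rewrite mulr_gt0 ?exprn_gt0.
have uS j : (j < d)%N -> u j.+1 * t = u j * s.
  by move=> jd; rewrite /u -(subnSK jd) !exprSr; ring.
elim=> [|j IH] jd; first by rewrite expr0 mul1r subn0 td.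
rewrite -/(u _) leNgt; apply/negP => lt.
have le1 := IH (ltnW jd); rewrite -/(u _) in le1.
(* Once a falls below the geometric sequence u, it decreases faster than u. *)
have rj : r j < s / t.
  rewrite /r ltr_pdivrMr ?a_gt0 ?(ltnW jd) // mulrAC ltr_pdivlMr //.
  apply: (lt_le_trans (y := u j.+1 * t)); first by rewrite ltr_pM2r.
  by rewrite uS // mulrC ler_pM2l.
(* A strict inequality propagated up to the index [d] contradicts [s ^+ d = a d]. *)
suff below m : (j.+1 + m <= d)%N -> a (j.+1 + m)%N < u (j.+1 + m)%N.
  have := below (d - j.+1)%N; rewrite !subnKC // => /(_ (leqnn _)).
  by rewrite -sd /u subnn expr0 mulr1 ltxx.
elim: m => [|m IHm] md; first by rewrite addn0.
rewrite addnS in md *.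
have am : 0 < a (j.+1 + m)%N by rewrite a_gt0 // ltnW.
have rm : r (j.+1 + m)%N < s / t.
  by apply: le_lt_trans rj; apply: r_noninc => //; lia.
rewrite -(ltr_pM2r t0) uS //.
move: rm; rewrite /r ltr_pdivrMr // mulrAC ltr_pdivlMr // => /lt_trans; apply.
by rewrite mulrC ltr_pM2r // IHm // ltnW.
Qed.

End Concave.

Lemma geometric_of_eq : (0 < d)%N ->
  (forall j, (j.+2 <= d)%N -> a j.+1 ^+ 2 = a j * a j.+2) ->
  forall j, (j <= d)%N -> a j = a 0 * (a 1 / a 0) ^+ j.
Proof.
move=> d0 h.
have a00 : a 0 != 0 by rewrite gt_eqF ?a_gt0.
(* The recurrence has order two, so two consecutive terms are carried along. *)
suff H j : (j.+1 <= d)%N ->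
    a j = a 0 * (a 1 / a 0) ^+ j /\ a j.+1 = a 0 * (a 1 / a 0) ^+ j.+1.
  by case=> [_|j /H[]//]; rewrite expr0 mulr1.
elim: j => [_|j IH jd]; first by rewrite expr0 expr1 mulr1 mulrCA divff ?mulr1.
have [e1 e2] := IH (ltnW jd); split=> //.
have aj : a j != 0 by rewrite gt_eqF ?a_gt0 //; lia.
apply: (mulfI aj); rewrite -h // e1 e2.
by rewrite !exprS; ring.
Qed.

End LogConcave.

(** * Hyperbolic multilinear forms *)

(** Inductive step of [rev_khovanskii]: the two bounds, multiplied by [h] and [t], are chained and
    the positive [p] cancels. *)
Lemma le_of_mul_le (R : realFieldType) (p q g h k t : R) :
  0 < p -> 0 <= t -> 0 <= h -> t * q <= k * p -> p * g <= q * h *+ 2 ->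
  t * g <= k *+ 2 * h.
Proof.
move=> p0 t0 h0 le1 le2; rewrite -(ler_pM2l p0).
apply: le_trans (_ : t * (q * h *+ 2) <= _); first by rewrite mulrCA ler_wpM2l.
have := ler_wpM2r h0 le1; lra.
Qed.

(** Binomial theorem for a symmetric form: [f l j k] stands for its value on [l] copies of [x + y],
    [j] of [x] and [k] of [y], and the hypothesis expands one copy of the sum. *)
Lemma pascal_sum (U : nmodType) (f : nat -> nat -> nat -> U) :
  (forall l j k, f l.+1 j k = f l j.+1 k + f l j k.+1) ->
  forall m j k, f m j k = \sum_(i < m.+1) f 0 (j + i)%N (k + (m - i))%N *+ 'C(m, i).
Proof.
move=> fS; elim=> [|m IH] j k.
  by rewrite big_ord1 /= !addn0.
rewrite fS !IH big_ord_recr [in RHS]big_ord_recr [X in _ + X]big_ord_recl.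
rewrite [in RHS]big_ord_recl /= !binn !bin0 !subnn !addn0 !subn0 !mulr1n.
rewrite addrAC [X in X + _ = _]addrCA !addSnnS; congr (_ + _ + _).
rewrite -big_split; apply: eq_bigr => i _.
rewrite /bump /= add1n binS mulrnDr addrC subSS addSnnS.
by rewrite addSnnS subnSK.
Qed.

Section HyperbolicForm.
Variables (R : realFieldType) (V : lmodType R) (F : seq V -> R).
Hypothesis F_perm : forall s t, perm_eq s t -> F s = F t.
Hypothesis F_linear : forall a x y s,
  F ((a *: x + y) :: s) = a * F (x :: s) + F (y :: s).

Lemma formDl x y s : F ((x + y) :: s) = F (x :: s) + F (y :: s).
Proof. by rewrite -[x]scale1r F_linear mul1r scale1r. Qed.

Lemma form0l s : F (0 :: s) = 0.
Proof. by apply: (@addrI _ (F (0 :: s))); rewrite -formDl !addr0. Qed.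

Lemma formZl a x s : F (a *: x :: s) = a * F (x :: s).
Proof. by rewrite -[a *: x]addr0 F_linear form0l addr0. Qed.

Lemma formBl x y s : F ((x - y) :: s) = F (x :: s) - F (y :: s).
Proof. by rewrite addrC -scaleN1r F_linear mulN1r addrC. Qed.

Lemma form_swap x y s : F [:: x, y & s] = F [:: y, x & s].
Proof. by apply: F_perm; apply/permPl; exact: (perm_catCA [:: x] [:: y] s). Qed.

Lemma form_cat_cons s x t : F (s ++ x :: t) = F (x :: s ++ t).
Proof. by apply: F_perm; rewrite perm_catC perm_cons perm_catC. Qed.

Lemma form_expand x y m :
  F (nseq m (x + y)) = \sum_(j < m.+1) F (nseq j x ++ nseq (m - j) y) *+ 'C(m, j).
Proof.
pose f l j k := F (nseq l (x + y) ++ nseq j x ++ nseq k y).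
have fS l j k : f l.+1 j k = f l j.+1 k + f l j k.+1.
  rewrite /f /= formDl -!form_cat_cons; congr (_ + _); apply: F_perm.
  by rewrite perm_cat2l perm_sym perm_catC perm_cons perm_catC.
by have := pascal_sum fS m 0%N 0%N; rewrite {1}/f cats0.
Qed.

(** Hodge index inequality. Unlike the Lorentzian signature, it survives limits of the classes in
    [s], where the form may degenerate. *)
Definition hyperbolic_at (s : seq V) := forall x y,
  0 < F [:: y, y & s] ->
  F [:: x, x & s] * F [:: y, y & s] <= F [:: x, y & s] ^+ 2.

(** Test the inequality on [t x + z] against [y]: the right side does not depend on [t], while the
    left one is affine in [t] because [x] is isotropic, so its slope vanishes. *)
Lemma hyperbolic_kernel s x y z : hyperbolic_at s ->
  0 < F [:: y, y & s] -> F [:: x, y & s] = 0 -> F [:: x, x & s] = 0 ->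
  F [:: x, z & s] = 0.
Proof.
move=> h yy xy xx.
suff : F [:: x, z & s] * F [:: y, y & s] *+ 2 = 0.
  by move/eqP; rewrite mulrn_eq0 /= mulf_eq0 (gt_eqF yy) orbF => /eqP.
apply: (@affine_bounded_slope0 _ (F [:: z, z & s] * F [:: y, y & s]) _
  (F [:: z, y & s] ^+ 2)) => t.
have := h (t *: x + z) y yy.
rewrite !F_linear !(form_swap _ (t *: x + z)) !F_linear xx xy (form_swap z x).
lra.
Qed.

(** Test the inequality on [p y + q z] against [x] and drop the nonnegative terms in [p^2] and
    [q^2]; [le_double_mul] then optimizes over [p] and [q]. *)
Lemma hyperbolic_product s x y z : hyperbolic_at s ->
  0 <= F [:: x, x & s] -> 0 <= F [:: y, y & s] -> 0 <= F [:: z, z & s] ->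
  0 <= F [:: x, y & s] -> 0 <= F [:: x, z & s] ->
  F [:: x, x & s] * F [:: y, z & s] <= F [:: x, y & s] * F [:: x, z & s] *+ 2.
Proof.
move=> h; rewrite le_eqVlt => /predU1P[<-|xx] yy zz xy xz.
  by rewrite mul0r mulrn_wge0 // mulr_ge0.
apply: le_double_mul => // p q.
have := h (p *: y + q *: z) x xx.
rewrite !F_linear !(form_swap _ (p *: y + q *: z)) !F_linear !formZl.
rewrite !(form_swap _ (q *: z)) !formZl (form_swap y x) (form_swap z x).
rewrite (form_swap z y) => hh.
have e1 : 0 <= p ^+ 2 * (F [:: y, y & s] * F [:: x, x & s]).
  by rewrite mulr_ge0 ?sqr_ge0 // mulr_ge0 // ltW.
have e2 : 0 <= q ^+ 2 * (F [:: z, z & s] * F [:: x, x & s]).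
  by rewrite mulr_ge0 ?sqr_ge0 // mulr_ge0 // ltW.
lra.
Qed.

(** * Limits of ample classes *)

Variable A : V -> Prop.

(** Closure of [A] for the weak topology of the functionals [z => F (z :: t)], tested on finitely
    many of them at a time; [V] carries no topology of its own. *)
Definition adherent (x : V) := forall (ts : seq (seq V)) (e : R), 0 < e ->
  exists2 w, A w & forall t, t \in ts -> `|F ((x - w) :: t)| < e.

Lemma mem_adherent x : A x -> adherent x.
Proof.
by move=> Ax ts e e0; exists x => // t _; rewrite subrr form0l normr0.
Qed.

(** If a symmetric property passes to the limit in its first slot, ample entries can be replaced by
    adherent ones slot after slot. *)
Lemma adherent_ind (Q : seq V -> Prop) (m : nat) :
  (forall s t, perm_eq s t -> Q s -> Q t) ->
  (forall x s, (size s).+1 = m -> adherent x ->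
     (forall w, A w -> Q (w :: s)) -> Q (x :: s)) ->
  (forall s, size s = m -> (forall x, x \in s -> A x) -> Q s) ->
  forall s, size s = m -> (forall x, x \in s -> adherent x) -> Q s.
Proof.
move=> Qperm Qadh QA s.
(* [t] collects the ample entries, [u] those that are only adherent. *)
suff H t u : size (t ++ u) = m -> (forall x, x \in t -> A x) ->
    (forall x, x \in u -> adherent x) -> Q (t ++ u).
  by move=> sm sN; apply: (H [::]).
elim: u t => [|x u IH] t sm tA uN; first by apply: QA; rewrite ?cats0 in sm *.
apply: (Qperm (x :: t ++ u)); first by rewrite perm_sym perm_catC perm_cons perm_catC.
apply: Qadh => [|| w Aw]; first by rewrite -sm !size_cat /= addnS.
  by apply: uN; rewrite mem_head.
apply: (IH (w :: t)); first by rewrite -sm !size_cat /= addnS.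
  by move=> y; rewrite inE => /predU1P[->|/tA].
by move=> y yu; apply: uN; rewrite inE yu orbT.
Qed.

Lemma adherent_le x (k1 k2 : R) t1 t2 : adherent x ->
  (forall w, A w -> k1 * F (w :: t1) <= k2 * F (w :: t2)) ->
  k1 * F (x :: t1) <= k2 * F (x :: t2).
Proof.
move=> Nx h; apply/ler_addgt0Pr => e e0.
(* The two sides move by at most [(|k1| + |k2|) * (e / k)] in total; the added 1 keeps [k]
   positive. *)
pose k := `|k1| + `|k2| + 1.
have k0 : 0 < k by rewrite ltr_wpDl // addr_ge0.
have [w Aw hw] := Nx [:: t1; t2] (e / k) (divr_gt0 e0 k0).
have h1 := hw t1 (mem_head _ _).
have h2 : `|F ((x - w) :: t2)| < e / k by apply: hw; rewrite !inE eqxx orbT.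
have := h w Aw; rewrite !formBl in h1 h2 *.
have b1 : k1 * (F (x :: t1) - F (w :: t1)) <= `|k1| * (e / k).
  by apply: le_trans (ler_norm _) _; rewrite normrM ler_wpM2l // ltW.
have b2 : - (k2 * (F (x :: t2) - F (w :: t2))) <= `|k2| * (e / k).
  by apply: le_trans (ler_norm _) _; rewrite normrN normrM ler_wpM2l // ltW.
have : (`|k1| + `|k2| + 1) * (e / k) = e by rewrite mulrC divfK // gt_eqF.
have : 0 < e / k by rewrite divr_gt0.
lra.
Qed.

Variable d : nat.
Hypothesis F_gt0 : forall s, size s = d -> (forall x, x \in s -> A x) -> 0 < F s.
Hypothesis F_hyperbolic : forall s, (size s).+2 = d ->
  (forall x, x \in s -> A x) -> hyperbolic_at s.

Lemma form_ge0 s : size s = d -> (forall x, x \in s -> adherent x) -> 0 <= F s.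
Proof.
apply: (adherent_ind (Q := fun s => 0 <= F s)) => [u t ut|x u _ Nx h|u ud uA];
  last exact/ltW/F_gt0.
  by rewrite (F_perm ut).
have := @adherent_le x 0 1 u u Nx.
by rewrite mul0r mul1r; apply=> w Aw; rewrite mul0r mul1r h.
Qed.

(** The inequality is polynomial in three values of [F], each linear in every entry of [s], so it
    passes to the limit by [le_sqr_of_approx]. *)
Lemma adherent_hyperbolic s : (size s).+2 = d ->
  (forall x, x \in s -> adherent x) -> hyperbolic_at s.
Proof.
case: d F_hyperbolic => [//|[//|m] hyp] [sm]; move: s sm.
apply: (adherent_ind (Q := hyperbolic_at)) => [s t st hs x y|x s _ Nx h|s sm sA].
- have st2 u v : F [:: u, v & s] = F [:: u, v & t].
    by apply: F_perm; rewrite !perm_cons.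
  by rewrite -!st2; apply: hs.
- move=> y z zz; apply: le_sqr_of_approx => // e e0.
  have [w Aw hw] := Nx [:: [:: y, y & s]; [:: z, z & s]; [:: y, z & s]] e e0.
  have rot u v : F [:: u, v, x & s] - F [:: u, v, w & s] = F [:: x - w, u, v & s].
    by rewrite !(form_cat_cons [:: u; v]) formBl.
  exists (F [:: y, y, w & s]), (F [:: z, z, w & s]), (F [:: y, z, w & s]).
  split; last by apply: h.
  + by rewrite rot hw // !inE eqxx.
  + by rewrite rot hw // !inE eqxx ?orbT.
  + by rewrite rot hw // !inE eqxx ?orbT.
- by apply: hyp => //; rewrite sm.
Qed.


(** Reverse Khovanskii-Teissier inequality. Each ample entry of [b] is traded for a copy of [x] by
    [hyperbolic_product], at the price of a factor 2; with no entry left both sides agree.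
    Positivity is a hypothesis because [x] is first taken ample, then big. *)
Lemma rev_khovanskii x m : adherent x ->
  (forall j s, (j + size s)%N = d -> (forall w, w \in s -> A w) ->
     0 < F (nseq j x ++ s)) ->
  forall j a b, (j + m).+1 = d -> size b = m -> adherent a ->
  (forall w, w \in b -> A w) ->
  F (nseq d x) * F (a :: nseq j x ++ b) <=
  F (a :: nseq d.-1 x) *+ 2 ^ m * F (x :: nseq j x ++ b).
Proof.
move=> Nx pos; elim: m => [|m IH] j a b jm bm Na bA.
  move/size0nil: bm => ->; rewrite cats0 -jm addn0 /= mulr1n.
  by rewrite mulrC.
case: b bm bA => [//|c b] /= [bm] bA.
have bA' w : w \in b -> A w by move=> wb; apply: bA; rewrite inE wb orbT.
have Ac : A c by apply: bA; rewrite mem_head.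
have Nc := mem_adherent Ac.
pose s := nseq j x ++ b.
have xs : nseq j.+1 x ++ b = x :: s by [].
have := IH j.+1 a b _ bm Na bA'; rewrite xs addSnnS => /(_ jm) IHa.
have sd : (size s).+2 = d by rewrite size_cat size_nseq bm -jm addnS.
have sN y : y \in s -> adherent y.
  rewrite mem_cat => /orP[/nseqP[->//]|/bA']; exact: mem_adherent.
have N2 u v : adherent u -> adherent v -> 0 <= F [:: u, v & s].
  move=> Nu Nv; apply: form_ge0 => //= y; rewrite !inE.
  by case/or3P=> [/eqP->|/eqP->|/sN].
have xxs : 0 < F [:: x, x & s].
  by apply: (pos j.+2 b) => //; rewrite -jm bm !addSn addnS.
have prod : F [:: x, x & s] * F [:: a, c & s] <=
    F [:: x, a & s] * F [:: x, c & s] *+ 2.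
  apply: hyperbolic_product; rewrite ?N2 //.
  exact: adherent_hyperbolic.
have F0 : 0 < F (nseq d x).
  by have := pos d [::]; rewrite cats0; apply; rewrite // addn0.
have -> : F (a :: nseq j x ++ c :: b) = F [:: a, c & s].
  rewrite form_swap; exact: (form_cat_cons (a :: nseq j x)).
have -> : F (x :: nseq j x ++ c :: b) = F [:: x, c & s].
  rewrite form_swap; exact: (form_cat_cons (x :: nseq j x)).
rewrite expnSr mulrnA; rewrite (form_swap a x) in IHa.
exact: le_of_mul_le xxs (ltW F0) (N2 x c Nx Nc) IHa prod.
Qed.

Definition big x := adherent x /\ 0 < F (nseq d x).

(** [F (x :: b)] cannot vanish: a constant multiple of it bounds the positive
    [F (nseq d x) * F (a :: b)]. The constant does not involve [b], so the bound is linear in each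
    entry of [b] and extends from ample to adherent ones. *)
Lemma replace_gt0 x : adherent x ->
  (forall j s, (j + size s)%N = d -> (forall w, w \in s -> A w) ->
     0 < F (nseq j x ++ s)) ->
  forall a b, (size b).+1 = d -> adherent a -> (forall w, w \in b -> adherent w) ->
  0 < F (a :: b) -> 0 < F (x :: b).
Proof.
move=> Nx pos a b bd Na bN ab.
have F0 : 0 < F (nseq d x).
  by have := pos d [::]; rewrite cats0; apply; rewrite // addn0.
suff le : F (nseq d x) * F (a :: b) <= F (a :: nseq d.-1 x) *+ 2 ^ d.-1 * F (x :: b).
  rewrite lt_neqAle eq_sym form_ge0 ?andbT //=; last first.
    by move=> y; rewrite inE => /predU1P[->|/bN].
  apply/eqP => xb; move: le; rewrite xb mulr0 leNgt => /negP; apply.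
  exact: mulr_gt0.
have bd' : size b = d.-1 by rewrite -bd.
have d0 : (0 < d)%N by rewrite -bd.
move: b bd' {bd ab} bN.
apply: (adherent_ind (Q := fun b => F (nseq d x) * F (a :: b) <=
  F (a :: nseq d.-1 x) *+ 2 ^ d.-1 * F (x :: b))) => [s t st|y s _ Ny h|s sd sA].
- have cons_st z : F (z :: s) = F (z :: t) by apply: F_perm; rewrite perm_cons.
  by rewrite !cons_st.
- rewrite (form_swap a y) (form_swap x y); apply: adherent_le => // w Aw.
  by rewrite (form_swap w a) (form_swap w x); apply: h.
- by apply: (rev_khovanskii Nx pos (j := 0%N)) => //; rewrite add0n prednK.
Qed.

(** Starting from [F (nseq d x)], copies of [x] are exchanged one by one for ample classes, which
    satisfy the positivity hypothesis of [replace_gt0] by [F_gt0]. *)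
Lemma big_nseq_gt0 x : big x -> forall j s, (j + size s)%N = d ->
  (forall w, w \in s -> A w) -> 0 < F (nseq j x ++ s).
Proof.
move=> [Nx F0] j s; elim: s j => [|w s IH] j jd sA.
  by rewrite cats0 -[j]addn0 jd.
have sA' y : y \in s -> A y by move=> ys; apply: sA; rewrite inE ys orbT.
have Aw : A w by apply: sA; rewrite mem_head.
rewrite form_cat_cons; apply: (replace_gt0 _ _ _ _ _ (IH j.+1 _ sA')) => //=.
- exact: mem_adherent.
- move=> i t id tA; apply: F_gt0; first by rewrite size_cat size_nseq.
  by move=> y; rewrite mem_cat => /orP[/nseqP[->]|/tA].
- by rewrite size_cat size_nseq -jd addnS.
- move=> y; rewrite mem_cat => /orP[/nseqP[->]//|/sA']; exact: mem_adherent.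
- by rewrite addSnnS.
Qed.

Lemma ample_big x : A x -> big x.
Proof.
move=> Ax; split; first exact: mem_adherent.
by apply: F_gt0; rewrite ?size_nseq // => y /nseqP[->].
Qed.

(** Second round of exchanges, now for big classes: [big_nseq_gt0] supplies the positivity that
    [replace_gt0] requires. *)
Lemma big_gt0 s : size s = d -> (forall x, x \in s -> big x) -> 0 < F s.
Proof.
case: s => [|x s] sd sB; first exact: F_gt0.
have [Nx F0] : big x by apply: sB; rewrite mem_head.
suff H j t : (j + size t)%N = d -> (forall x, x \in t -> big x) ->
    0 < F (nseq j x ++ t) by apply: (H 0%N).
elim: t j => [|w t IH] j jd tB; first by rewrite cats0 -[j]addn0 jd.
have tB' y : y \in t -> big y by move=> yt; apply: tB; rewrite inE yt orbT.
have Bw : big w by apply: tB; rewrite mem_head.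
rewrite form_cat_cons; apply: (replace_gt0 _ _ _ _ _ (IH j.+1 _ tB')) => //=.
- by case: Bw.
- exact: big_nseq_gt0.
- by rewrite size_cat size_nseq -jd addnS.
- by move=> y; rewrite mem_cat => /orP[/nseqP[->]//|/tB'[]].
- by rewrite addSnnS.
Qed.

(** * Mixed intersection numbers of two big classes *)

Section TwoClasses.
Variables x y : V.
Hypotheses (x_big : big x) (y_big : big y).

Lemma mixed_gt0 j : (j <= d)%N -> 0 < F (nseq j x ++ nseq (d - j) y).
Proof.
move=> jd; apply: big_gt0; first by rewrite size_cat !size_nseq subnKC.
by move=> z; rewrite mem_cat => /orP[]/nseqP[->].
Qed.

(** Khovanskii-Teissier inequality: reverse Cauchy-Schwarz for [x] and [y], the other slots holding
    [j] copies of [x] and [d - j.+2] of [y]. *)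
Lemma mixed_log_concave j : (j.+2 <= d)%N ->
  F (nseq j x ++ nseq (d - j) y) * F (nseq j.+2 x ++ nseq (d - j.+2) y) <=
  F (nseq j.+1 x ++ nseq (d - j.+1) y) ^+ 2.
Proof.
move=> jd; pose s := nseq j x ++ nseq (d - j.+2) y.
have hs : hyperbolic_at s.
  apply: adherent_hyperbolic.
    by rewrite size_cat !size_nseq; lia.
  by move=> z; rewrite mem_cat => /orP[]/nseqP[-> _]; [case: x_big|case: y_big].
have <- : F [:: x, y & s] = F (nseq j.+1 x ++ nseq (d - j.+1) y).
  apply: F_perm; rewrite -(subnSK (m := j.+1)) //= perm_cons; apply/permPl.
  exact: (perm_catCA [:: y]).
have <- : F [:: y, y & s] = F (nseq j x ++ nseq (d - j) y).
  apply: F_perm; rewrite -(subnSK (m := j)) ?(ltnW jd) // -(subnSK (m := j.+1)) //.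
  by apply/permPl; exact: (perm_catCA [:: y; y]).
rewrite mulrC; have := hs y x; rewrite mulrC (form_swap y x); apply.
have := mixed_gt0 jd; exact.
Qed.

End TwoClasses.

Lemma collinear_of_geometric x y a b : big x -> big y ->
  (forall j, (j <= d)%N -> F (nseq j x ++ nseq (d - j) y) = a ^+ j * b ^+ (d - j)) ->
  forall s z, (size s).+2 = d -> (forall w, w \in s -> A w) ->
  F [:: b *: x - a *: y, z & s] = 0.
Proof.
move=> xB yB xy_geo; set u := b *: x - a *: y.
have F_u s : F (u :: s) = b * F (x :: s) - a * F (y :: s) by rewrite formBl !formZl.
(* Orthogonality of [u] to all monomials with [m] ample factors. Each stage frees one slot by the
   kernel criterion, and the next stage puts an ample class there. *)
pose mix m := forall s i j, size s = m -> (i + j + m).+1 = d ->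
  (forall w, w \in s -> A w) -> F (u :: nseq i x ++ nseq j y ++ s) = 0.
have mix_kernel m : mix m -> forall s i j z, size s = m -> (i + j + m).+2 = d ->
    (forall w, w \in s -> A w) ->
    F [:: u, z & nseq i x ++ nseq j y ++ s] = 0.
  move=> mixm s i j z sm ijd sA; set t := nseq i x ++ nseq j y ++ s.
  have tN w : w \in t -> big w.
    by rewrite !mem_cat => /or3P[/nseqP[->]|/nseqP[->]|/sA/ample_big].
  have td : (size t).+2 = d by rewrite !size_cat !size_nseq -ijd sm; lia.
  have xt : F [:: u, x & t] = 0.
    by apply: (mixm s i.+1 j) => //; rewrite addSn.
  have yt : F [:: u, y & t] = 0.
    rewrite -(mixm s i j.+1 sm _ sA) ?addnS //; apply: F_perm.
    by rewrite perm_cons; apply/permPl; exact: (perm_catCA [:: y]).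
  (* Here [x] is the positive vector; [u] is orthogonal to [x] and [y], hence to itself. *)
  apply: (@hyperbolic_kernel t u x) => //.
  - by apply: adherent_hyperbolic => // w /tN[].
  - by apply: big_gt0 => // w; rewrite !inE => /or3P[/eqP->|/eqP->|/tN].
  - by rewrite F_u (form_swap x) (form_swap y) xt yt !mulr0 subrr.
have mix_all m : mix m.
  elim: m => [|m IH] s i j sm ijd sA.
    (* Without ample factors, the geometric values give [b * (a^(i+1) b^j) - a * (a^i b^(j+1)) =
       0]. *)
    rewrite (size0nil sm) cats0 F_u.
    have <- : F (nseq i.+1 x ++ nseq (d - i.+1) y) = F (x :: nseq i x ++ nseq j y).
      by rewrite -ijd; congr (F (_ ++ nseq _ _)); lia.
    rewrite -(form_cat_cons (nseq i x) y) -[y :: nseq j y]/(nseq j.+1 y).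
    have <- : (d - i)%N = j.+1 by lia.
    rewrite !xy_geo; [|lia..].
    by rewrite (_ : d - i = (d - i.+1).+1)%N; [rewrite !exprS; ring|lia].
  case: s sm sA => [//|w s] [sm] sA.
  have sA' y' : y' \in s -> A y' by move=> ys; apply: sA; rewrite inE ys orbT.
  rewrite -(mix_kernel m IH s i j w sm _ sA'); last by rewrite -ijd addnS.
  apply: F_perm; rewrite perm_cons !catA; apply/permPl.
  exact: (perm_catCA (nseq i x ++ nseq j y) [:: w] s).
by move=> s z sd sA; apply: (mix_kernel (size s) (mix_all _) s 0%N 0%N).
Qed.

End HyperbolicForm.

(** * Shuffle product *)

Section Shuffle.
Variables (R : comNzRingType) (T : Type).
Implicit Types (f g h : seq T -> R) (v : T) (s t : seq T).

(** The product [wedge] at one point of one chart, on arbitrary functions of lists, so that its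
    identities go by induction on the arguments. *)
Definition shuffle f g s : R :=
  \sum_(m : (size s).-tuple bool)
    (-1) ^+ shuffle_inv m * (f (mask m s) * g (mask (map negb m) s)).

Definition contract v f : seq T -> R := fun t => f (v :: t).

(** Grading involution; it carries the Koszul signs without any homogeneity assumption. *)
Definition sgn_twist f : seq T -> R := fun t => (-1) ^+ size t * f t.

Lemma shuffle_nil f g : shuffle f g [::] = f [::] * g [::].
Proof.
rewrite /shuffle (big_pred1 [tuple]) => [|m]; first by rewrite mul1r.
exact/esym/eqP/tuple0.
Qed.

(** Contraction is an antiderivation. Masks are split by their first bit; when it is false, [v]
    passes all the arguments given to [f], whence the twist. *)
Lemma shuffle_cons f g v s :
  shuffle f g (v :: s) =
  shuffle (contract v f) g s + shuffle (sgn_twist f) (contract v g) s.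
Proof.
rewrite {1}/shuffle /=.
rewrite (reindex (fun p : bool * (size s).-tuple bool => [tuple of p.1 :: p.2])).
  rewrite -(pair_big predT predT (fun b (m : (size s).-tuple bool) =>
    (-1) ^+ shuffle_inv (b :: m) *
    (f (mask (b :: m) (v :: s)) * g (mask (map negb (b :: m)) (v :: s))))) /=.
  rewrite big_bool /=; congr (_ + _); apply: eq_bigr => m _.
  rewrite /sgn_twist size_mask ?size_tuple // exprD -!mulrA.
  by rewrite mulrCA.
exists (fun m => (thead m, [tuple of behead m])) => [[b m] _|m _] /=.
  by rewrite theadE; congr (_, _); apply: val_inj.
by apply: val_inj; rewrite /= [in RHS](tuple_eta m).
Qed.

Lemma eq_shuffle f f' g g' : f =1 f' -> g =1 g' -> shuffle f g =1 shuffle f' g'.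
Proof. by move=> ff gg s; apply: eq_bigr => m _; rewrite ff gg. Qed.

Lemma shuffle_linearl a f f' g s :
  shuffle (fun t => a * f t + f' t) g s = a * shuffle f g s + shuffle f' g s.
Proof.
rewrite /shuffle mulr_sumr -big_split; apply: eq_bigr => m _ /=; ring.
Qed.

Lemma shuffle_linearr a f g g' s :
  shuffle f (fun t => a * g t + g' t) s = a * shuffle f g s + shuffle f g' s.
Proof.
rewrite /shuffle mulr_sumr -big_split; apply: eq_bigr => m _ /=; ring.
Qed.

Lemma shuffleDl f f' g s :
  shuffle (fun t => f t + f' t) g s = shuffle f g s + shuffle f' g s.
Proof.
by rewrite -[X in X + _]mul1r -shuffle_linearl; apply: eq_shuffle => // t; rewrite mul1r.
Qed.

Lemma shuffleDr f g g' s :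
  shuffle f (fun t => g t + g' t) s = shuffle f g s + shuffle f g' s.
Proof.
by rewrite -[X in X + _]mul1r -shuffle_linearr; apply: eq_shuffle => // t; rewrite mul1r.
Qed.

Lemma shuffle0l f g s : (forall t, f t = 0) -> shuffle f g s = 0.
Proof. by move=> f0; apply: big1 => m _; rewrite f0 mul0r mulr0. Qed.

Lemma shuffle0r f g s : (forall t, g t = 0) -> shuffle f g s = 0.
Proof. by move=> g0; apply: big1 => m _; rewrite g0 !mulr0. Qed.

Lemma shuffleNl f g s : shuffle (fun t => - f t) g s = - shuffle f g s.
Proof. by rewrite /shuffle -sumrN; apply: eq_bigr => m _; ring. Qed.

Lemma shuffleNr f g s : shuffle f (fun t => - g t) s = - shuffle f g s.
Proof. by rewrite /shuffle -sumrN; apply: eq_bigr => m _; ring. Qed.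

Lemma sgn_twistK f : sgn_twist (sgn_twist f) =1 f.
Proof. by move=> t; rewrite /sgn_twist mulrA -expr2 sqrr_sign mul1r. Qed.

Lemma contract_sgn_twist v f t :
  contract v (sgn_twist f) t = - sgn_twist (contract v f) t.
Proof. by rewrite /contract /sgn_twist /= exprS mulN1r mulNr. Qed.

Lemma size_mask_negb m s : size m = size s ->
  (size (mask m s) + size (mask (map negb m) s))%N = size s.
Proof. by elim: m s => [|[] m IH] [|v s] //= [/IH]; lia. Qed.

Lemma shuffle_sgn_twist f g :
  shuffle (sgn_twist f) (sgn_twist g) =1 sgn_twist (shuffle f g).
Proof.
move=> s; rewrite /shuffle /sgn_twist mulr_sumr; apply: eq_bigr => m _.
have -> : (-1) ^+ size s = (-1) ^+ size (mask m s) *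
    (-1) ^+ size (mask (map negb m) s) :> R.
  by rewrite -exprD size_mask_negb ?size_tuple.
ring.
Qed.

(** By the antiderivation rule both sides contract to the same three terms; the last one uses that
    the twist is multiplicative. *)
Lemma shuffleA f g h :
  shuffle (shuffle f g) h =1 shuffle f (shuffle g h).
Proof.
move=> s; elim: s f g h => [|v s IH] f g h; first by rewrite !shuffle_nil mulrA.
rewrite !shuffle_cons.
rewrite (@eq_shuffle _ (fun t => shuffle (contract v f) g t +
  shuffle (sgn_twist f) (contract v g) t) h h) //; last first.
  by move=> t; rewrite /contract shuffle_cons.
rewrite (@eq_shuffle (sgn_twist f) (sgn_twist f) _
  (fun t => shuffle (contract v g) h t +
    shuffle (sgn_twist g) (contract v h) t)) //; last first.
  by move=> t; rewrite /contract shuffle_cons.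
rewrite shuffleDl shuffleDr !IH -addrA; congr (_ + (_ + _)).
by rewrite -IH; apply: eq_shuffle => // t; rewrite shuffle_sgn_twist.
Qed.

(** Graded commutativity: only [f] needs a parity, as the sign is carried by the twist of [g].
    Contraction flips the parity of [f] in the induction. *)
Lemma shuffle_comm b f g :
  (forall t, odd (size t) != b -> f t = 0) ->
  shuffle f g =1 shuffle (if b then sgn_twist g else g) f.
Proof.
move=> fb s; elim: s f g b fb => [|v s IH] f g b fb.
  rewrite !shuffle_nil; case: b fb => _; last by rewrite mulrC.
  by rewrite /sgn_twist mul1r mulrC.
have cb t : odd (size t) != ~~ b -> contract v f t = 0.
  by move=> tb; apply: fb => /=; move: tb; case: (odd _); case: b.
have tw t : sgn_twist f t = (-1) ^+ b * f t.
  rewrite /sgn_twist -signr_odd; have [->//|/fb->] := eqVneq (odd (size t)) b.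
  by rewrite !mulr0.
rewrite !shuffle_cons (IH _ g _ cb) addrC.
have {cb fb} := IH f (contract v g) b fb.
case: b {IH} tw => /= tw IH.
  rewrite (@eq_shuffle _ (fun t => - f t) _ (contract v g)) //; last first.
    by move=> t; rewrite tw mulN1r.
  rewrite shuffleNl IH; congr (_ + _).
    rewrite -shuffleNl; apply: eq_shuffle => // t.
    by rewrite contract_sgn_twist.
  by apply: eq_shuffle => // t; rewrite sgn_twistK.
congr (_ + _).
by rewrite -IH; apply: eq_shuffle => // t; rewrite tw mul1r.
Qed.

Lemma shuffle_homogeneous k l f g :
  (forall s, size s <> k -> f s = 0) -> (forall s, size s <> l -> g s = 0) ->
  forall s, size s <> (k + l)%N -> shuffle f g s = 0.
Proof.
move=> fk gl s skl; apply: big1 => m _.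
have [mk|/eqP/fk->] := eqVneq (size (mask m s)) k; last by rewrite mul0r mulr0.
rewrite (gl (mask _ s)) ?mulr0 // => ml; apply: skl.
by rewrite -mk -ml size_mask_negb ?size_tuple.
Qed.

Lemma shuffle_unitl f s : shuffle (fun t => (nilp t)%:R) f s = f s.
Proof.
elim: s f => [|v s IH] f; first by rewrite shuffle_nil mul1r.
rewrite shuffle_cons shuffle0l // add0r -[RHS](IH (contract v f)).
by apply: eq_shuffle => // -[|w t]; rewrite /sgn_twist /= ?mul1r ?mulr0.
Qed.

Lemma shuffle_unitr f s : shuffle f (fun t => (nilp t)%:R) s = f s.
Proof.
rewrite -(@shuffle_comm false) ?shuffle_unitl // => t.
by case: t => //= v t; case: (odd _).
Qed.

End Shuffle.

(** Naturality under pullback, meant for chart transitions and for the scalar action that defines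
    type (p,p). *)
Lemma shuffle_map (R : comNzRingType) (T U : Type) (p : T -> U) (f g : seq U -> R) s :
  shuffle f g (map p s) = shuffle (f \o map p) (g \o map p) s.
Proof.
elim: s f g => [|v s IH] f g; first by rewrite !shuffle_nil.
rewrite /= !shuffle_cons !IH; congr (_ + _).
by apply: eq_shuffle => // t; rewrite /sgn_twist /= size_map.
Qed.

(** * Alternating multilinear maps *)

Section Alternating.
Variables (R : realType) (V : lmodType R).
Implicit Types (f g : seq V -> R) (u v : V) (s : seq V).

Definition multilinear f := forall s1 s2 (a : R) u v,
  f (s1 ++ (a *: u + v) :: s2) = a * f (s1 ++ u :: s2) + f (s1 ++ v :: s2).

(** With repeats in adjacent slots only, two contractions by one vector suffice to treat shuffles;
    [null_of_repeat] recovers all repeats. *)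
Definition adjacent_null f := forall s1 s2 u, f (s1 ++ [:: u, u & s2]) = 0.

Lemma multilinear_contract v f : multilinear f -> multilinear (contract v f).
Proof. by move=> fl s1 s2 a u w; exact: (fl (v :: s1)). Qed.

Lemma multilinear_sgn_twist f : multilinear f -> multilinear (sgn_twist f).
Proof.
by move=> fl s1 s2 a u w; rewrite /sgn_twist fl !size_cat /=; ring.
Qed.

Lemma adjacent_null_contract v f : adjacent_null f -> adjacent_null (contract v f).
Proof. by move=> fl s1 s2 u; exact: (fl (v :: s1)). Qed.

Lemma adjacent_null_sgn_twist f : adjacent_null f -> adjacent_null (sgn_twist f).
Proof. by move=> fl s1 s2 u; rewrite /sgn_twist fl mulr0. Qed.

Lemma multilinear_shuffle f g :
  multilinear f -> multilinear g -> multilinear (shuffle f g).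
Proof.
move=> fl gl s1; elim: s1 f g fl gl => [|w s1 IH] f g fl gl s2 a u v /=.
  rewrite !shuffle_cons mulrDr addrACA -shuffle_linearl -shuffle_linearr.
  congr (_ + _); apply: eq_shuffle => // t; first exact: (fl [::]).
  exact: (gl [::]).
rewrite !shuffle_cons !IH; [ring|..].
all: by [exact: multilinear_contract | exact: multilinear_sgn_twist | ].
Qed.

(** Contracting twice by [u] leaves two null terms and two cross terms, which cancel since
    contraction anticommutes with the twist. *)
Lemma adjacent_null_shuffle f g :
  adjacent_null f -> adjacent_null g -> adjacent_null (shuffle f g).
Proof.
move=> fl gl s1; elim: s1 f g fl gl => [|w s1 IH] f g fl gl s2 u /=.
  rewrite !shuffle_cons (@shuffle0l _ _ (contract u (contract u f))) ?add0r; last first.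
    by move=> t; apply: (fl [::]).
  rewrite (@shuffle0r _ _ _ (contract u (contract u g))) ?addr0; last first.
    by move=> t; apply: (gl [::]).
  rewrite (@eq_shuffle _ _ (contract u (sgn_twist f))
    (fun t => - sgn_twist (contract u f) t) (contract u g) (contract u g)) //.
    by rewrite shuffleNl subrr.
  exact: contract_sgn_twist.
rewrite !shuffle_cons !IH ?addr0 //.
all: by [exact: adjacent_null_contract | exact: adjacent_null_sgn_twist].
Qed.

(** Polarization in adjacent slots gives a sign under adjacent swaps, and such swaps bring two equal
    entries together. *)
Lemma null_of_repeat f s : multilinear f -> adjacent_null f -> ~~ uniq s -> f s = 0.
Proof.
move=> fl f0.
have swap s1 s2 u v : f (s1 ++ [:: u, v & s2]) = - f (s1 ++ [:: v, u & s2]).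
  have := f0 s1 s2 (1 *: u + v).
  rewrite fl.
  have lin2 w : f (s1 ++ [:: w, 1 *: u + v & s2]) =
      f (s1 ++ [:: w, u & s2]) + f (s1 ++ [:: w, v & s2]).
    by have := fl (rcons s1 w) s2 1 u v; rewrite !cat_rcons mul1r.
  by rewrite !lin2 mul1r !f0 add0r addr0 => /eqP; rewrite addr_eq0 => /eqP.
have repeat s1 s2 s3 u : f (s1 ++ u :: s2 ++ u :: s3) = 0.
  elim: s2 s1 => [|w s2 IH] s1; first exact: f0.
  by rewrite /= swap -cat_rcons IH oppr0.
have : forall s0, ~~ uniq s -> f (s0 ++ s) = 0.
  elim: s => [//|u s IH] s0 /=; rewrite negb_and negbK => /orP[us|/IH].
    by case/splitPr: us => s2 s3; exact: repeat.
  by rewrite -cat_rcons => ->.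
by move/(_ [::]).
Qed.

Lemma alternating_shuffle k l f g :
  alternating_map k f -> alternating_map l g -> alternating_map (k + l) (shuffle f g).
Proof.
move=> [fk fl f0] [gk gl g0].
have adj h : (forall s, ~~ uniq s -> h s = 0) -> adjacent_null h.
  move=> h0 s1 s2 u; apply: h0.
  by rewrite cat_uniq /= inE eqxx /= !andbF.
split; first exact: shuffle_homogeneous.
  exact: multilinear_shuffle.
move=> s; apply: null_of_repeat; first exact: multilinear_shuffle.
by apply: adjacent_null_shuffle; apply: adj.
Qed.

End Alternating.

(** * Smooth functions and exterior derivative *)

Lemma near_eq_differentiable (R : realType) (V W : normedModType R)
    (f g : V -> W) (x : V) :
  {near x, f =1 g} -> differentiable f x -> differentiable g x.
Proof.
move=> fg /diff_locallyP[df_cont df].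
have gx : f x = g x := nbhs_singleton fg.
have dg : g \o shift x = cst (g x) + 'd f x +o_ 0 id.
  apply/eqaddoP => e e0.
  have /eqaddoP /(_ e e0) := df.
  apply: filter_app.
  have : \forall h \near 0, f (h + x) = g (h + x).
    by move: fg; rewrite (near_shift 0) subr0.
  apply: filter_app; near=> h => fgh.
  by rewrite !fctE /= fgh gx.
have E := diff_unique df_cont dg.
by apply/diff_locallyP; rewrite E.
Unshelve. all: by end_near. Qed.

Section Smooth.
Variables (R : realType) (V : normedModType R) (U : set V).
Hypothesis U_open : open U.
Implicit Types f g : V -> R^o.

Lemma near_of_eq_on (W : Type) (f g : V -> W) x :
  (forall y, U y -> f y = g y) -> U x -> {near x, f =1 g}.
Proof.
move=> fg Ux; have : nbhs x U by exact: open_nbhs_nbhs.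
exact: filterS.
Qed.

(** Smoothness to a finite order, peeling off the derivative taken first, so that sums and products
    go by induction on [m]. *)
Fixpoint smooth_upto (m : nat) f : Prop :=
  (forall x, U x -> differentiable f x) /\
  if m is m'.+1 then forall v, smooth_upto m' ('D_v f) else True.

Lemma smooth_onP f : smooth_on U f <-> forall m, smooth_upto m f.
Proof.
split=> [fs m|fs vs].
  elim: m f fs => [|m IH] f fs; split=> //; [exact: (fs [::])..|move=> v].
  (* [foldr] applies the last direction of the list first, so lists grow on the right. *)
  by apply: IH => vs x Ux; have := fs (rcons vs v) x Ux; rewrite foldr_rcons.
have {fs} := fs (size vs); elim/last_ind: vs f => [|vs v IH] f; first by case.
by rewrite size_rcons foldr_rcons => -[_ /(_ v) /IH].
Qed.

Lemma smooth_upto_differentiable m f x : smooth_upto m f -> U x -> differentiable f x.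
Proof. by case: m => [|m] [fd _] /fd. Qed.

Lemma smooth_upto_derivable m f x v : smooth_upto m f -> U x -> derivable f x v.
Proof. by move=> fs Ux; apply/diff_derivable/(smooth_upto_differentiable fs Ux). Qed.

Lemma smooth_uptoS m f : smooth_upto m.+1 f -> smooth_upto m f.
Proof.
elim: m f => [|m IH] f [fd fD]; split=> // v; exact/IH/fD.
Qed.

Lemma eq_smooth_upto m f g :
  (forall x, U x -> f x = g x) -> smooth_upto m f -> smooth_upto m g.
Proof.
elim: m f g => [|m IH] f g fg [fd fD]; split=> //.
1,2: by move=> x Ux; apply: near_eq_differentiable (fd x Ux); exact: near_of_eq_on.
move=> v; apply: IH (fD v) => x Ux.
by apply: near_eq_derive; exact: near_of_eq_on.
Qed.

Lemma smooth_upto_cst m (a : R) : smooth_upto m (fun=> a : R^o).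
Proof.
elim: m a => [|m IH] a; split=> //.
move=> v; rewrite (_ : 'D_v _ = fun=> 0); first exact: IH.
by apply/funext => y; exact: derive_cst.
Qed.

Lemma smooth_uptoD m f g :
  smooth_upto m f -> smooth_upto m g -> smooth_upto m (fun x => f x + g x : R^o).
Proof.
elim: m f g => [|m IH] f g fs gs; split=> //.
1,2: move=> x Ux; apply: differentiableD.
1,3: exact: smooth_upto_differentiable fs Ux.
1,2: exact: smooth_upto_differentiable gs Ux.
move=> v; apply: (@eq_smooth_upto _ (fun x => 'D_v f x + 'D_v g x : R^o)).
  move=> x Ux; symmetry; apply: deriveD.
    exact: smooth_upto_derivable fs Ux.
  exact: smooth_upto_derivable gs Ux.
by apply: IH; [case: fs => _; exact | case: gs => _; exact].
Qed.

Lemma smooth_uptoM m f g :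
  smooth_upto m f -> smooth_upto m g -> smooth_upto m (fun x => f x * g x : R^o).
Proof.
elim: m f g => [|m IH] f g fs gs; split=> //.
1,2: move=> x Ux; apply: differentiableM.
1,3: exact: smooth_upto_differentiable fs Ux.
1,2: exact: smooth_upto_differentiable gs Ux.
move=> v; apply: (@eq_smooth_upto _ (fun x => f x * 'D_v g x + g x * 'D_v f x : R^o)).
  move=> x Ux; symmetry; apply: deriveM.
    exact: smooth_upto_derivable fs Ux.
  exact: smooth_upto_derivable gs Ux.
apply: smooth_uptoD; apply: IH; try exact: smooth_uptoS.
  by case: gs => _; exact.
by case: fs => _; exact.
Qed.

Lemma smooth_on_cst (a : R) : smooth_on U (fun=> a : R^o).
Proof. by apply/smooth_onP => m; exact: smooth_upto_cst. Qed.

Lemma smooth_onD f g :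
  smooth_on U f -> smooth_on U g -> smooth_on U (fun x => f x + g x : R^o).
Proof.
by move=> /smooth_onP fs /smooth_onP gs; apply/smooth_onP => m; exact: smooth_uptoD.
Qed.

Lemma smooth_onM f g :
  smooth_on U f -> smooth_on U g -> smooth_on U (fun x => f x * g x : R^o).
Proof.
by move=> /smooth_onP fs /smooth_onP gs; apply/smooth_onP => m; exact: smooth_uptoM.
Qed.

Lemma smooth_on_shuffle (h k : V -> seq V -> R^o) s :
  (forall t, smooth_on U (h^~ t)) -> (forall t, smooth_on U (k^~ t)) ->
  smooth_on U (fun x => shuffle (h x) (k x) s : R^o).
Proof.
elim: s h k => [|v s IH] h k hs ks.
  rewrite (_ : (fun _ => _) = fun x => h x [::] * k x [::] : R^o); last first.
    by apply/funext => x; rewrite shuffle_nil.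
  exact: smooth_onM.
rewrite (_ : (fun _ => _) = fun x => shuffle (contract v (h x)) (k x) s +
    shuffle (sgn_twist (h x)) (contract v (k x)) s : R^o); last first.
  by apply/funext => x; rewrite shuffle_cons.
apply: smooth_onD; apply: IH => // t; [exact: hs | | exact: ks].
by apply: smooth_onM => //; exact: smooth_on_cst.
Qed.

End Smooth.

(** * Exterior derivative and the graded Leibniz rule *)

Section ExteriorDerivative.
Variables (R : realType) (V : normedModType R).
Implicit Types (h k : V -> seq V -> R^o) (y v : V) (s : seq V).

Definition ext_deriv h y s : R :=
  \sum_(p < size s)
    (-1) ^+ p * 'D_(nth 0 s p) (fun z => h z (take p s ++ drop p.+1 s)) y.

(** Cartan formula for the constant vector field [v]. *)
Lemma ext_deriv_cons h y v s :
  ext_deriv h y (v :: s) =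
  'D_v (h^~ s) y - ext_deriv (fun z => contract v (h z)) y s.
Proof.
rewrite /ext_deriv big_ord_recl /= mul1r drop0; congr (_ + _).
by rewrite -sumrN; apply: eq_bigr => p _; rewrite exprS mulN1r mulNr.
Qed.

Definition form_derivable h y := forall t v, derivable (h^~ t) y v.

Lemma form_derivable_contract h y v :
  form_derivable h y -> form_derivable (fun z => contract v (h z)) y.
Proof. by move=> hd t; exact: hd. Qed.

Lemma form_derivable_sgn_twist h y :
  form_derivable h y -> form_derivable (fun z => sgn_twist (h z)) y.
Proof. by move=> hd t v; apply: derivableM => //; exact: hd. Qed.

Lemma derive_sgn_twist h y v s : form_derivable h y ->
  'D_v (fun z => sgn_twist (h z) s : R^o) y = sgn_twist (fun t => 'D_v (h^~ t) y) s.
Proof. by move=> hd; rewrite /sgn_twist; apply: deriveMl; exact: hd. Qed.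

(** The exterior derivative raises degrees by one, so it anticommutes with the grading
    involution. *)
Lemma ext_deriv_sgn_twist h y s : form_derivable h y ->
  ext_deriv (fun z => sgn_twist (h z)) y s = - sgn_twist (ext_deriv h y) s.
Proof.
move=> hd; rewrite /ext_deriv /sgn_twist mulr_sumr -sumrN; apply: eq_bigr => p _.
rewrite derive_sgn_twist // /sgn_twist size_cat size_take size_drop ltn_ord.
have -> : (p + (size s - p.+1))%N = (size s).-1 by have := ltn_ord p; lia.
have -> : (-1) ^+ size s = - (-1) ^+ (size s).-1 :> R.
  by rewrite -[in LHS](ltn_predK (ltn_ord p)) exprS mulN1r.
ring.
Qed.

Lemma ext_derivD h k y s : form_derivable h y -> form_derivable k y ->
  ext_deriv (fun z t => h z t + k z t) y s = ext_deriv h y s + ext_deriv k y s.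
Proof.
move=> hd kd; rewrite /ext_deriv -big_split; apply: eq_bigr => p _ /=.
by rewrite -mulrDr; congr (_ * _); apply: deriveD; [exact: hd|exact: kd].
Qed.

Lemma is_derive_shuffle h k y v s : form_derivable h y -> form_derivable k y ->
  is_derive y v (fun z => shuffle (h z) (k z) s : R^o)
    (shuffle (fun t => 'D_v (h^~ t) y) (k y) s +
     shuffle (h y) (fun t => 'D_v (k^~ t) y) s).
Proof.
elim: s h k => [|w s IH] h k hd kd.
  rewrite (_ : (fun _ => _) = fun z => h z [::] * k z [::] : R^o); last first.
    by apply/funext => z; rewrite shuffle_nil.
  split; first by apply: derivableM; [exact: hd|exact: kd].
  rewrite [LHS](deriveM (hd [::] v) (kd [::] v)) !shuffle_nil addrC.
  by congr (_ + _); exact: mulrC.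
rewrite (_ : (fun _ => _) = (fun z => shuffle (contract w (h z)) (k z) s : R^o) +
    (fun z => shuffle (sgn_twist (h z)) (contract w (k z)) s : R^o)); last first.
  by apply/funext => z; rewrite shuffle_cons.
have d1 := IH _ _ (form_derivable_contract (v := w) hd) kd.
have d2 := IH _ _ (form_derivable_sgn_twist hd) (form_derivable_contract (v := w) kd).
apply: is_derive_eq; rewrite !shuffle_cons addrACA; congr (_ + _ + (_ + _)).
by apply: eq_shuffle => // t; rewrite derive_sgn_twist.
Qed.

Lemma form_derivable_shuffle h k y : form_derivable h y -> form_derivable k y ->
  form_derivable (fun z => shuffle (h z) (k z)) y.
Proof. by move=> hd kd t v; case: (is_derive_shuffle v t hd kd). Qed.

(** Induction on the arguments: after contraction by [v], the Cartan formula reduces the rule to the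
    Leibniz rule for the directional derivative and to the contracted factors; [e3] and [e4] match
    the signs of the mixed terms. *)
Lemma ext_deriv_shuffle h k y s : form_derivable h y -> form_derivable k y ->
  ext_deriv (fun z => shuffle (h z) (k z)) y s =
  shuffle (ext_deriv h y) (k y) s + shuffle (sgn_twist (h y)) (ext_deriv k y) s.
Proof.
elim: s h k => [|v s IH] h k hd kd.
  by rewrite !shuffle_nil /ext_deriv !big_ord0 mul0r mulr0 addr0.
rewrite ext_deriv_cons.
have [_ ->] := is_derive_shuffle v s hd kd.
have hv := form_derivable_contract (v := v) hd.
have kv := form_derivable_contract (v := v) kd.
have ht := form_derivable_sgn_twist hd.
rewrite (_ : (fun z => contract v _) = fun z t =>
    shuffle (contract v (h z)) (k z) t +
    shuffle (sgn_twist (h z)) (contract v (k z)) t); last first.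
  by apply/funext => z; apply/funext => t; rewrite /contract shuffle_cons.
rewrite (ext_derivD _ (form_derivable_shuffle hv kd) (form_derivable_shuffle ht kv)).
rewrite !IH // !shuffle_cons.
have e1 : shuffle (contract v (ext_deriv h y)) (k y) s =
    shuffle (fun t => 'D_v (h^~ t) y) (k y) s -
    shuffle (ext_deriv (fun z => contract v (h z)) y) (k y) s.
  rewrite -shuffleNl -shuffleDl; apply: eq_shuffle => // t.
  by rewrite /contract ext_deriv_cons.
have e2 : shuffle (sgn_twist (sgn_twist (h y))) (contract v (ext_deriv k y)) s =
    shuffle (h y) (fun t => 'D_v (k^~ t) y) s -
    shuffle (h y) (ext_deriv (fun z => contract v (k z)) y) s.
  rewrite -shuffleNr -shuffleDr; apply: eq_shuffle => t; first exact: sgn_twistK.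
  by rewrite /contract ext_deriv_cons.
have e3 : shuffle (ext_deriv (fun z => sgn_twist (h z)) y) (contract v (k y)) s =
    - shuffle (sgn_twist (ext_deriv h y)) (contract v (k y)) s.
  rewrite -shuffleNl; apply: eq_shuffle => // t; exact: ext_deriv_sgn_twist.
have e4 : shuffle (contract v (sgn_twist (h y))) (ext_deriv k y) s =
    - shuffle (sgn_twist (contract v (h y))) (ext_deriv k y) s.
  rewrite -shuffleNl; apply: eq_shuffle => // t; exact: contract_sgn_twist.
have e5 : shuffle (sgn_twist (sgn_twist (h y)))
      (ext_deriv (fun z => contract v (k z)) y) s =
    shuffle (h y) (ext_deriv (fun z => contract v (k z)) y) s.
  by apply: eq_shuffle => // t; exact: sgn_twistK.
rewrite e1 e2 e3 e4 e5; ring.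
Qed.

End ExteriorDerivative.

(** * Differential forms on a complex manifold *)

Section Forms.
Variables (R : realType) (n : nat) (X : topologicalType).
Variable M : complex_manifold R n X.
Implicit Types (f g eta : diff_form M) (ws : seq (diff_form M)).

Lemma wedgeA f g h : wedge (wedge f g) h = wedge f (wedge g h).
Proof. by apply/funext => i; apply/funext => y; apply/funext => s; exact: shuffleA. Qed.

Lemma wedge_form1l f : wedge (@form1 R n X M) f = f.
Proof.
by apply/funext => i; apply/funext => y; apply/funext => s; exact: shuffle_unitl.
Qed.

Lemma wedge_form1r f : wedge f (@form1 R n X M) = f.
Proof.
by apply/funext => i; apply/funext => y; apply/funext => s; exact: shuffle_unitr.
Qed.

Lemma wedge_linearl (a : R) f g h :
  wedge (a *: f + g) h = a *: wedge f h + wedge g h.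
Proof.
by apply/funext => i; apply/funext => y; apply/funext => s; exact: shuffle_linearl.
Qed.

Lemma wedge_scalel (a : R) f h : wedge (a *: f) h = a *: wedge f h.
Proof.
apply/funext => i; apply/funext => y; apply/funext => s.
rewrite -[LHS]/(shuffle (fun t => a * f i y t) (h i y) s).
rewrite -[RHS]/(a * shuffle (f i y) (h i y) s) /shuffle mulr_sumr.
by apply: eq_bigr => m _; ring.
Qed.

Lemma wprod_cat ws ws' eta : wprod (ws ++ ws') eta = wprod ws (wprod ws' eta).
Proof. exact: foldr_cat. Qed.

Lemma wedge_wpow f k g : wedge (wpow f k) g = wprod (nseq k f) g.
Proof.
elim: k => [|k IH]; first exact: wedge_form1l.
by rewrite /= -IH -wedgeA.
Qed.

Lemma chart_image_open i : open (@chart_image R n X M i).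
Proof. exact: image_open. Qed.

Lemma smooth_form_derivable k eta i y : smooth_form k eta -> chart_image i y ->
  form_derivable (eta i) y.
Proof. by move=> [_ es _] iy t v; exact/diff_derivable/(es i t [::]). Qed.

Lemma smooth_form0 k : smooth_form k (0 : diff_form M).
Proof.
split=> // [i y iy|i s]; last exact: smooth_on_cst.
by split=> // s1 s2 a u v; rewrite mulr0 addr0.
Qed.

Lemma smooth_form_linear k (a : R) f g :
  smooth_form k f -> smooth_form k g -> smooth_form k (a *: f + g).
Proof.
move=> [fa fs ft] [ga gs gt]; split.
- move=> i y iy; have [fk fl f0] := fa i y iy; have [gk gl g0] := ga i y iy.
  split=> [s sk|s1 s2 b u v|s su].
  + by rewrite -[LHS]/(a * f i y s + g i y s) fk // gk // mulr0 addr0.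
  + have E s : (a *: f + g) i y s = a * f i y s + g i y s by [].
    by rewrite !E fl gl; ring.
  + by rewrite -[LHS]/(a * f i y s + g i y s) f0 // g0 // mulr0 addr0.
- move=> i s; apply: smooth_onD => //; first exact: chart_image_open.
  by apply: smooth_onM => //; [exact: chart_image_open | exact: smooth_on_cst].
- move=> i j y s ijy.
  have E i' y' s' : (a *: f + g) i' y' s' = a * f i' y' s' + g i' y' s' by [].
  by rewrite !E (ft i j) // (gt i j).
Qed.

Lemma smooth_form_wedge k l f g :
  smooth_form k f -> smooth_form l g -> smooth_form (k + l) (wedge f g).
Proof.
move=> [fa fs ft] [ga gs gt]; split.
- by move=> i y iy; apply: alternating_shuffle; [exact: fa|exact: ga].
- move=> i s; exact: (smooth_on_shuffle (@chart_image_open i) s (fs i) (gs i)).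
- move=> i j y s ijy; rewrite [RHS]shuffle_map.
  by apply: eq_shuffle => t; [exact: ft | exact: gt].
Qed.

Lemma dform_linear k (a : R) f g i y s : smooth_form k f -> smooth_form k g ->
  chart_image i y -> dform (a *: f + g) i y s = a * dform f i y s + dform g i y s.
Proof.
move=> fs gs iy; rewrite /dform mulr_sumr -big_split; apply: eq_bigr => p _ /=.
set t := take p s ++ drop p.+1 s; set v := nth 0 s p.
have fd : derivable ((f i)^~ t) y v := @smooth_form_derivable k f i y fs iy t v.
have gd : derivable ((g i)^~ t) y v := @smooth_form_derivable k g i y gs iy t v.
have -> : 'D_v (fun z => (a *: f + g) i z t) y =
    a * 'D_v (fun z => f i z t) y + 'D_v (fun z => g i z t) y.
  rewrite -(deriveMl a fd) -(deriveD _ gd) //.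
  exact: derivableM (derivable_cst _ _ _) fd.
ring.
Qed.

Lemma dform_wedge k l f g i y s : smooth_form k f -> smooth_form l g ->
  chart_image i y ->
  dform (wedge f g) i y s =
  wedge (dform f) g i y s + shuffle (sgn_twist (f i y)) (dform g i y) s.
Proof.
move=> fs gs iy.
apply: ext_deriv_shuffle.
  exact (@smooth_form_derivable k f i y fs iy).
exact (@smooth_form_derivable l g i y gs iy).
Qed.

Lemma closed_wedge k l f g : smooth_form k f -> smooth_form l g ->
  closed_form f -> closed_form g -> closed_form (wedge f g).
Proof.
move=> fs gs fc gc i y s iy; rewrite (dform_wedge _ fs gs iy).
rewrite [X in X + _]shuffle0l ?add0r; last by move=> t; exact: fc.
by apply: shuffle0r => t; exact: gc.
Qed.

Lemma Hpp_wedge p q f g : Hpp p f -> Hpp q g -> Hpp (p + q) (wedge f g).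
Proof.
move=> [fs fc ft] [gs gc gt]; split.
- by rewrite doubleD; exact: smooth_form_wedge.
- exact: closed_wedge fs gs fc gc.
- move=> i y s a b iy; rewrite {1}/wedge -/(shuffle _ _ _) shuffle_map.
  rewrite exprD -[wedge f g i y s]/(shuffle _ _ s).
  have lin c e (u w : seq (Cn R n) -> R) : c * e * shuffle u w s =
      shuffle (fun t => c * u t) (fun t => e * w t) s.
    by rewrite /shuffle mulr_sumr; apply: eq_bigr => m _; ring.
  by rewrite lin; apply: eq_shuffle => t; [exact: ft | exact: gt].
Qed.

Lemma Hpp_wprod p ws eta : Hpp p eta -> (forall w, w \in ws -> Hpp 1 w) ->
  Hpp (size ws + p) (wprod ws eta).
Proof.
move=> etaH; elim: ws => [//|w ws IH] wsH.
rewrite [(size _ + p)%N]addSn -add1n; apply: Hpp_wedge.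
  by apply: wsH; rewrite mem_head.
by apply: IH => u uw; apply: wsH; rewrite inE uw orbT.
Qed.

Lemma Hpp0 p : Hpp p (0 : diff_form M).
Proof.
split; first exact: smooth_form0.
- move=> i y s iy; apply: big1 => q _.
  by rewrite (_ : (fun _ => _) = cst 0) // derive_cst mulr0.
- by move=> i y s a b iy; rewrite mulr0.
Qed.

Lemma Hpp_linear p (a : R) f g : Hpp p f -> Hpp p g -> Hpp p (a *: f + g).
Proof.
move=> [fs fc ft] [gs gc gt]; split; first exact: smooth_form_linear.
- by move=> i y s iy; rewrite (dform_linear _ _ fs gs) // fc // gc // mulr0 addr0.
- move=> i y s b c iy.
  have E s' : (a *: f + g) i y s' = a * f i y s' + g i y s' by [].
  by rewrite !E ft // gt //; ring.
Qed.

(** Forms are unconstrained off the chart images, so identities that rely on the degree, such as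
    commutativity, hold only in this sense. *)
Definition chart_eq f g := forall i y s, chart_image i y -> f i y s = g i y s.

Lemma chart_eq_cohomologous f g : chart_eq f g -> cohomologous f g.
Proof.
move=> fg; exists 0%N, 0; split=> [|i y s iy]; first exact: smooth_form0.
by have [_ -> //] := Hpp0 0; rewrite fg // subrr.
Qed.

Lemma cohomologous_scale (a : R) f g :
  cohomologous f g -> cohomologous (a *: f) (a *: g).
Proof.
move=> [k [th [ths fg]]]; exists k, (a *: th + 0); split.
  by apply: smooth_form_linear => //; exact: smooth_form0.
move=> i y s iy; rewrite (dform_linear _ _ ths (smooth_form0 k)) //.
have [_ -> //] := Hpp0 0; rewrite -fg // addr0.
have E h : (a *: h) i y s = a * h i y s :> R by [].
by rewrite !E mulrBr.
Qed.

(** If [f - f'] is the differential of [th], then, [g] being closed, the difference of the products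
    is that of [wedge th g]. *)
Lemma cohomologous_wedgel l f f' g : smooth_form l g -> closed_form g ->
  cohomologous f f' -> cohomologous (wedge f g) (wedge f' g).
Proof.
move=> gs gc [k [th [ths ff']]]; exists (k + l)%N, (wedge th g).
split=> [|i y s iy]; first exact: smooth_form_wedge.
have -> : dform (wedge th g) i y s = shuffle (dform th i y) (g i y) s.
  rewrite (dform_wedge _ ths gs iy) [X in _ + X]shuffle0r ?addr0 // => t.
  exact: gc.
rewrite -[LHS]/(shuffle (f i y) (g i y) s - shuffle (f' i y) (g i y) s).
rewrite -shuffleNl -shuffleDl; apply: eq_shuffle => // t; exact: ff'.
Qed.

Lemma wedge_even_comm p f g : smooth_form p.*2 f -> chart_eq (wedge f g) (wedge g f).
Proof.
move=> [fa _ _] i y s iy; apply: (@shuffle_comm _ _ false) => t todd.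
have [fk _ _] := fa i y iy; apply: fk => tp.
by move: todd; rewrite tp odd_double.
Qed.

Lemma cohomologous_wedger p f g g' : smooth_form p.*2 f -> closed_form f ->
  cohomologous g g' -> cohomologous (wedge f g) (wedge f g').
Proof.
move=> fs fc /(cohomologous_wedgel fs fc)[k [th [ths gg']]].
exists k, th; split=> // i y s iy.
by rewrite !(wedge_even_comm _ fs) // gg'.
Qed.

Lemma cohomologous_wprod ws g g' : (forall w, w \in ws -> Hpp 1 w) ->
  cohomologous g g' -> cohomologous (wprod ws g) (wprod ws g').
Proof.
move=> + gg'; elim: ws => [//|w ws IH] wsH.
have [ws1 wc _] : Hpp 1 w by apply: wsH; rewrite mem_head.
apply: (cohomologous_wedger (p := 1)) => //.
by apply: IH => u uw; apply: wsH; rewrite inE uw orbT.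
Qed.

Lemma chart_eq_wedger f g g' : chart_eq g g' -> chart_eq (wedge f g) (wedge f g').
Proof. by move=> gg' i y s iy; apply: eq_shuffle => // t; exact: gg'. Qed.

Lemma wedge_even_CA p f g h : smooth_form p.*2 f ->
  chart_eq (wedge f (wedge g h)) (wedge g (wedge f h)).
Proof.
move=> fs i y s iy; rewrite -!wedgeA; apply: eq_shuffle => // t.
exact: wedge_even_comm fs _ _ _ iy.
Qed.

Lemma wprod_perm ws ws' eta : (forall w, w \in ws -> Hpp 1 w) ->
  perm_eq ws ws' -> chart_eq (wprod ws eta) (wprod ws' eta).
Proof.
elim: ws ws' => [|w ws IH] ws' wsH; first by rewrite perm_sym => /perm_nilP->.
move=> pw; have : w \in ws' by rewrite -(perm_mem pw) mem_head.
move=> /splitPr ws'_split; case: ws'_split pw => t u.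
rewrite perm_sym perm_catC cat_cons perm_cons perm_catC perm_sym => pw.
have wH : smooth_form 1.*2 w by have [] : Hpp 1 w by apply: wsH; rewrite mem_head.
have tu : chart_eq (wprod ws eta) (wprod (t ++ u) eta).
  by apply: IH pw => v vw; apply: wsH; rewrite inE vw orbT.
suff front : chart_eq (wedge w (wprod (t ++ u) eta)) (wprod (t ++ w :: u) eta).
  by move=> i y s iy; rewrite -front //; exact: chart_eq_wedger.
elim: t {pw tu} => [//|v t IHt] i y s iy /=.
by rewrite (wedge_even_CA _ _ wH) //; exact: chart_eq_wedger.
Qed.

End Forms.

(** * Intersection form on (1,1)-classes *)

Definition closed11 (R : realType) (n : nat) (X : topologicalType)
    (M : complex_manifold R n X) : {pred idx M -> Cn R n -> seq (Cn R n) -> R^o} :=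
  fun f => `[< Hpp (M := M) 1 f >].

Lemma closed11P (R : realType) (n : nat) (X : topologicalType)
    (M : complex_manifold R n X) (f : diff_form M) :
  reflect (Hpp 1 f) (f \in @closed11 R n X M).
Proof. exact: asboolP. Qed.

Lemma closed11_submod (R : realType) (n : nat) (X : topologicalType)
    (M : complex_manifold R n X) : submod_closed (@closed11 R n X M).
Proof.
split=> [|a f g /closed11P fH /closed11P gH]; apply/closed11P; first exact: Hpp0.
exact: Hpp_linear.
Qed.

HB.instance Definition _ (R : realType) (n : nat) (X : topologicalType)
    (M : complex_manifold R n X) :=
  GRing.isSubmodClosed.Build R (idx M -> Cn R n -> seq (Cn R n) -> R^o)
    (@closed11 R n X M) (@closed11_submod R n X M).

(** Closed (1,1)-forms as a genuine [R]-module, to which the abstract multilinear results apply. No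
    quotient is taken: equality of classes remains the relation [cohomologous]. *)
Record form11 (R : realType) (n : nat) (X : topologicalType)
    (M : complex_manifold R n X) := Form11 {
  form11_val : idx M -> Cn R n -> seq (Cn R n) -> R^o;
  _ : form11_val \in @closed11 R n X M }.

HB.instance Definition _ (R : realType) (n : nat) (X : topologicalType)
  (M : complex_manifold R n X) := [isSub for @form11_val R n X M].
HB.instance Definition _ (R : realType) (n : nat) (X : topologicalType)
  (M : complex_manifold R n X) := [Choice of form11 M by <:].
HB.instance Definition _ (R : realType) (n : nat) (X : topologicalType)
  (M : complex_manifold R n X) := [SubChoice_isSubLmodule of form11 M by <:].


Lemma form11P (R : realType) (n : nat) (X : topologicalType)
  (M : complex_manifold R n X) (x : form11 M) : Hpp 1 (val x : diff_form M).
Proof. exact/closed11P/(valP x). Qed.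

Section DiagonalForm.
Variables (R : realFieldType) (m : nat) (l : 'I_m.+1 -> R).
Hypotheses (l0_gt0 : 0 < l ord0) (l_lt0 : forall i, i != ord0 -> l i < 0).

(** Subtract from [a] the multiple of [b] that cancels its positive coordinate: the form is
    nonpositive on [a - t b], and completing a square concludes. *)
Lemma lorentzian_reverse_cauchy_schwarz (a b : 'I_m.+1 -> R) :
  0 < \sum_i b i * b i * l i ->
  (\sum_i a i * a i * l i) * (\sum_i b i * b i * l i) <=
  (\sum_i a i * b i * l i) ^+ 2.
Proof.
move=> bb.
have le0 (c : 'I_m.+1 -> R) : c ord0 = 0 -> \sum_i c i * c i * l i <= 0.
  move=> c0; apply: sumr_le0 => i _.
  have [->|/l_lt0/ltW li] := eqVneq i ord0; first by rewrite c0 !mul0r.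
  by rewrite mulr_ge0_le0 // -expr2 sqr_ge0.
have b0 : b ord0 != 0 by apply/eqP => /le0; rewrite leNgt bb.
pose t := a ord0 / b ord0.
have := le0 (fun i => a i - t * b i); rewrite /t divfK // subrr -/t => /(_ erefl).
have -> : \sum_i (a i - t * b i) * (a i - t * b i) * l i =
    \sum_i a i * a i * l i - t * (\sum_i a i * b i * l i) *+ 2 +
    t ^+ 2 * \sum_i b i * b i * l i.
  rewrite !mulr_sumr -sumrMnl -sumrB -big_split /=; apply: eq_bigr => i _; ring.
move: (\sum_i a i * a i * l i) (\sum_i b i * b i * l i) bb => p q q0.
move: (\sum_i a i * b i * l i) => r h.
have := mulr_ge0_le0 (ltW q0) h; have := sqr_ge0 (t * q - r); lra.
Qed.

End DiagonalForm.

Section IntersectionForm.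
Variables (R : realType) (n d : nat) (X : topologicalType).
Variables (M : complex_manifold R n X) (I : diff_form M -> R).
Variable Omega : diff_form M.
Hypotheses (I_integration : integration I) (dn : (d <= n)%N).
Hypothesis Omega_Hpp : Hpp (n - d) Omega.
Implicit Types (x y : form11 M) (s t : seq (form11 M)) (f g : diff_form M).

Let vals s : seq (diff_form M) := map val s.

(* The value 0 on lists of the wrong length makes symmetry and linearity
   unconditional. *)
Definition intersection s : R :=
  if size s == d then I (wprod (vals s) Omega) else 0.

Lemma vals_Hpp s w : w \in vals s -> Hpp 1 w.
Proof. by move=> /mapP[x _ ->]; exact: form11P. Qed.

Lemma smooth_wprod_vals s : size s = d -> smooth_form n.*2 (wprod (vals s) Omega).
Proof.
move=> sd; have [+ _ _] := Hpp_wprod Omega_Hpp (@vals_Hpp s).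
by rewrite size_map sd subnKC.
Qed.

Lemma integral_eq f g : smooth_form n.*2 f -> smooth_form n.*2 g ->
  cohomologous f g -> I f = I g.
Proof. by case: I_integration => + _ _; apply. Qed.

Lemma intersection_perm s t : perm_eq s t -> intersection s = intersection t.
Proof.
move=> st; rewrite /intersection -(perm_size st); case: eqP => // sd.
apply: integral_eq; first exact: smooth_wprod_vals.
  by apply: smooth_wprod_vals; rewrite -(perm_size st).
apply/chart_eq_cohomologous/wprod_perm; first exact: vals_Hpp.
exact: perm_map.
Qed.

Lemma intersection_linear (a : R) x y s :
  intersection ((a *: x + y) :: s) = a * intersection (x :: s) + intersection (y :: s).
Proof.
rewrite /intersection /=; case: eqP => [sd|_]; last by rewrite mulr0 addr0.
case: I_integration => _ Ilin _.
rewrite -(Ilin a _ _ (@smooth_wprod_vals (x :: s) sd) (@smooth_wprod_vals (y :: s) sd)).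
by congr (I _); exact: wedge_linearl.
Qed.

Lemma intersection_cohomologous x y s :
  cohomologous (val x : diff_form M) (val y) ->
  intersection (x :: s) = intersection (y :: s).
Proof.
move=> xy; rewrite /intersection /=; case: eqP => // sd.
apply: integral_eq (@smooth_wprod_vals (x :: s) sd) (@smooth_wprod_vals (y :: s) sd) _.
have [ws wc _] := Hpp_wprod Omega_Hpp (@vals_Hpp s).
exact: cohomologous_wedgel ws wc xy.
Qed.

Let form0 := form0l intersection_linear.
Let formD := formDl intersection_linear.
Let formZ := formZl intersection_linear.
Let form_sw := form_swap intersection_perm.

Definition ample11 x := ample (val x : diff_form M).

Lemma nef_adherent x : nef (val x : diff_form M) -> adherent intersection ample11 x.
Proof.
move=> [_ xnef] ts e e0.
have insubE f (fH : Hpp 1 f) : val (insubd (0 : form11 M) f) = f.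
  by apply: insubdK; exact/closed11P.
(* This seminorm bounds all the required functionals at once. [insubd] returns 0 off the closed
   (1,1)-forms, where [seminorm_H11] asks nothing. *)
pose p f := \sum_(t <- ts) `|intersection (insubd 0 f :: t)|.
have p_semi : seminorm_H11 p.
  split=> [f g fH gH fg|f _|f g fH gH|a f fH].
  - apply: eq_bigr => t _; congr `|_|; apply: intersection_cohomologous.
    by rewrite !insubE.
  - by apply: sumr_ge0 => t _; exact: normr_ge0.
  - rewrite /p -big_split; apply: ler_sum => t _ /=.
    rewrite (_ : insubd 0 (f + g) = insubd 0 f + insubd 0 g :> form11 M).
      by rewrite formD ler_normD.
    apply: val_inj; rewrite raddfD /= !insubE //.
    by rewrite -[f]scale1r; exact: Hpp_linear.
  - rewrite /p mulr_sumr; apply: eq_bigr => t _ /=.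
    rewrite (_ : insubd 0 (a *: f) = a *: insubd 0 f :> form11 M).
      by rewrite formZ normrM.
    apply: val_inj; rewrite linearZ /= !insubE //.
    by rewrite -[_ *: f]addr0; apply: Hpp_linear => //; exact: Hpp0.
have [w [wA pw]] := xnef p e p_semi e0.
have wH : Hpp 1 w by case: wA.
exists (insubd 0 w) => [|t tts]; first by rewrite /ample11 insubE.
apply: le_lt_trans pw; rewrite /p.
have -> : x - insubd 0 w = insubd 0 (val x - w).
  apply: val_inj; rewrite raddfB /= !insubE //.
  by rewrite addrC -scaleN1r; apply: Hpp_linear => //; exact: form11P.
rewrite (big_rem t) //= lerDl; apply: sumr_ge0 => u _; exact: normr_ge0.
Qed.

Section Lorentzian.
Hypothesis Omega_lorentzian : strictly_lorentzian I d Omega.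

Lemma intersection_gt0 s : size s = d -> (forall x, x \in s -> ample11 x) ->
  0 < intersection s.
Proof.
move=> sd sA; rewrite /intersection sd eqxx.
have vd : size (vals s) == d by rewrite size_map sd.
case: Omega_lorentzian => _ + _ => /(_ (Tuple vd)); apply=> k.
have : tnth (Tuple vd) k \in vals s by rewrite (mem_tnth k (Tuple vd)).
by case/mapP => x xs ->; exact: sA.
Qed.

Lemma lorentzian_coordinates s : (size s).+2 = d ->
  (forall x, x \in s -> ample11 x) ->
  exists (m : nat) (e : 'I_m.+1 -> form11 M),
  [/\ forall x, exists c : 'I_m.+1 -> R,
        cohomologous (val x : diff_form M) (val (\sum_i c i *: e i)),
      forall i j, i != j -> intersection [:: e i, e j & s] = 0,
      0 < intersection [:: e ord0, e ord0 & s]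
    & forall i, i != ord0 -> intersection [:: e i, e i & s] < 0].
Proof.
move=> sd sA.
have vd : size (vals s) == (d - 2)%N by rewrite size_map -sd subn2.
case: Omega_lorentzian => _ _ /(_ (Tuple vd)) [k|m [e [eH e_basis orth e0 eN]]].
  have : tnth (Tuple vd) k \in vals s by rewrite (mem_tnth k (Tuple vd)).
  by case/mapP => x xs ->; exact: sA.
exists m, (fun i => Form11 (introT (closed11P _) (eH i))).
have sd' : (size s).+2 == d by rewrite sd.
split=> [x|i j ij||i i0]; last 3 first.
- by rewrite /intersection /= sd' orth.
- by rewrite /intersection /= sd'.
- by rewrite /intersection /= sd' eN.
have [c [xc _]] := e_basis _ (form11P x); exists c.
by rewrite raddf_sum; congr (cohomologous _ _): xc.
Qed.

Lemma intersection_sum (J : finType) (c : J -> R) (e : J -> form11 M) s :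
  intersection ((\sum_i c i *: e i) :: s) = \sum_i c i * intersection (e i :: s).
Proof.
apply: (big_rec2 (fun u v => intersection (u :: s) = v)) => [|i u v _ <-].
  exact: form0.
by rewrite intersection_linear.
Qed.

Lemma intersection_hyperbolic s : (size s).+2 = d ->
  (forall x, x \in s -> ample11 x) -> hyperbolic_at intersection s.
Proof.
move=> sd sA; have [m [e [coord orth e0 eN]]] := lorentzian_coordinates sd sA.
pose l i := intersection [:: e i, e i & s].
have diag x y (a b : 'I_m.+1 -> R) :
    cohomologous (val x : diff_form M) (val (\sum_i a i *: e i)) ->
    cohomologous (val y : diff_form M) (val (\sum_i b i *: e i)) ->
    intersection [:: x, y & s] = \sum_i a i * b i * l i.
  move=> xa yb; rewrite (intersection_cohomologous _ xa) intersection_sum.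
  apply: eq_bigr => i _; rewrite form_sw (intersection_cohomologous _ yb).
  rewrite intersection_sum (bigD1 i) //= big1 ?addr0 ?mulrA // => j ji.
  by rewrite orth ?mulr0.
move=> x y; have [a xa] := coord x; have [b yb] := coord y.
rewrite (diag x x a a) // (diag y y b b) // (diag x y a b) //.
exact: lorentzian_reverse_cauchy_schwarz.
Qed.

(** Pairing with a vector of the diagonalizing basis isolates one coordinate, times a nonzero
    diagonal entry. *)
Lemma intersection_nondegenerate s x : (size s).+2 = d ->
  (forall w, w \in s -> ample11 w) ->
  (forall z, intersection [:: x, z & s] = 0) -> cohomologous (val x : diff_form M) 0.
Proof.
move=> sd sA x0; have [m [e [coord orth e0 eN]]] := lorentzian_coordinates sd sA.
have [c xc] := coord x.
have c0 i : c i = 0.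
  have := x0 (e i); rewrite (intersection_cohomologous _ xc) intersection_sum.
  rewrite (bigD1 i) //= big1 ?addr0 => [/eqP|j ji]; last by rewrite orth ?mulr0.
  rewrite mulf_eq0 => /orP[/eqP//|/eqP ei0].
  have [i0|i0] := eqVneq i ord0; first by move: e0; rewrite -i0 ei0 ltxx.
  by have := eN i i0; rewrite ei0 ltxx.
move: xc; rewrite big1 // => i _; by rewrite c0 scale0r.
Qed.

End Lorentzian.
End IntersectionForm.

(** * Nef and big classes *)

Lemma powR_expn_inv (R : realType) (d : nat) (z : R) :
  (0 < d)%N -> 0 <= z -> (z ^+ d) `^ (d%:R^-1) = z.
Proof.
move=> d0 z0; rewrite -powR_mulrn // -powRrM mulfV ?powRr1 //.
by rewrite pnatr_eq0 -lt0n.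
Qed.

Lemma expn_powR_inv (R : realType) (d : nat) (z : R) :
  (0 < d)%N -> 0 <= z -> (z `^ (d%:R^-1)) ^+ d = z.
Proof.
move=> d0 z0; rewrite -powR_mulrn ?powR_ge0 // -powRrM mulVf ?powRr1 //.
by rewrite pnatr_eq0 -lt0n.
Qed.

Lemma wprod_scale (R : realType) (n : nat) (X : topologicalType)
    (M : complex_manifold R n X) (c : R) (ws : seq (diff_form M)) (g : diff_form M) :
  wprod ws (c *: g) = c *: wprod ws g.
Proof.
elim: ws => [//|w ws IH]; rewrite /= IH.
apply/funext => i; apply/funext => z; apply/funext => s.
set h := wprod ws g.
rewrite -[LHS]/(shuffle (w i z) (fun t => c * h i z t) s).
rewrite -[RHS]/(c * shuffle (w i z) (h i z) s) /shuffle mulr_sumr.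
by apply: eq_bigr => m _; ring.
Qed.

(** * The implications between the five conditions *)

Section Equivalences.
Variables (R : realType) (n d : nat) (X : topologicalType).
Variables (M : complex_manifold R n X) (I : diff_form M -> R).
Variable Omega : diff_form M.
Hypotheses (M_kahler : compact_kahler M) (I_integration : integration I).
Hypotheses (d_gt1 : (1 < d)%N) (dn : (d <= n)%N).
Hypothesis Omega_lorentzian : strictly_lorentzian I d Omega.
Variables (x y : form11 M).
Let alpha : diff_form M := val x.
Let beta : diff_form M := val y.
Hypotheses (x_nef : nef alpha) (y_nef : nef beta).
Hypotheses (x_big : 0 < vol I d Omega alpha) (y_big : 0 < vol I d Omega beta).

Let Omega_Hpp : Hpp (n - d) Omega.
Proof. by case: Omega_lorentzian. Qed.

Let F := intersection d I Omega.

Let F_perm : forall s t, perm_eq s t -> F s = F t :=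
  intersection_perm I_integration dn Omega_Hpp.
Let F_linear : forall c z z' s,
    F ((c *: z + z') :: s) = c * F (z :: s) + F (z' :: s) :=
  intersection_linear I_integration dn Omega_Hpp.
Let F_gt0 := @intersection_gt0 _ _ _ _ _ _ _ Omega_lorentzian.
Let F_hyperbolic :=
  @intersection_hyperbolic _ _ _ _ _ _ _ I_integration dn Omega_Hpp Omega_lorentzian.

Let a j := F (nseq j x ++ nseq (d - j) y).

Let map_vals j k : map val (nseq j x ++ nseq k y) = nseq j alpha ++ nseq k beta.
Proof. by rewrite map_cat !map_nseq. Qed.

Let wprod_size (s : seq (form11 M)) :
  size s = d -> F s = I (wprod (map val s) Omega).
Proof. by move=> sd; rewrite /F /intersection sd eqxx. Qed.

Let vol_nseq (z : form11 M) : vol I d Omega (val z) = F (nseq d z).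
Proof. by rewrite wprod_size ?size_nseq // map_nseq /vol wedge_wpow. Qed.

Let mixed_nseq j k : (j + k)%N = d ->
  mixed I Omega alpha beta j k = F (nseq j x ++ nseq k y).
Proof.
move=> jk; rewrite wprod_size ?size_cat ?size_nseq // map_vals.
by rewrite wprod_cat /mixed !wedge_wpow.
Qed.

Let mixedE j : (j <= d)%N -> mixed I Omega alpha beta j (d - j) = a j.
Proof. by move=> jd; rewrite mixed_nseq // subnKC. Qed.

Let mixed_equalities : (forall j, (j.+2 <= d)%N -> a j.+1 ^+ 2 = a j * a j.+2) <->
  forall k : nat, (1 <= k <= d - 1)%N ->
    mixed I Omega alpha beta k (d - k) ^+ 2 =
      mixed I Omega alpha beta (k - 1) (d - k + 1) *
      mixed I Omega alpha beta (k + 1) (d - k - 1).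
Proof.
have E j : (j.+2 <= d)%N -> [/\ mixed I Omega alpha beta j.+1 (d - j.+1) = a j.+1,
    mixed I Omega alpha beta (j.+1 - 1) (d - j.+1 + 1) = a j &
    mixed I Omega alpha beta (j.+1 + 1) (d - j.+1 - 1) = a j.+2].
  by move=> jd; rewrite -!mixedE; [split; congr mixed; lia | lia..].
split=> [eqs [//|j] jd|eqs j jd].
  have jd2 : (j.+2 <= d)%N by lia.
  by have [-> -> ->] := E j jd2; exact: eqs.
have jd1 : (1 <= j.+1 <= d - 1)%N by lia.
by have := eqs j.+1 jd1; have [-> -> ->] := E j jd.
Qed.

Let a0 : a 0 = vol I d Omega beta.
Proof. by rewrite vol_nseq /a subn0. Qed.

Let ad : a d = vol I d Omega alpha.
Proof. by rewrite vol_nseq /a subnn cats0. Qed.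

Let bigx : big F (@ample11 _ _ _ M) d x.
Proof. by split; [exact: nef_adherent | rewrite -vol_nseq]. Qed.

Let bigy : big F (@ample11 _ _ _ M) d y.
Proof. by split; [exact: nef_adherent | rewrite -vol_nseq]. Qed.

Let a_gt0 j : (j <= d)%N -> 0 < a j.
Proof. exact: (mixed_gt0 F_perm F_linear F_gt0 F_hyperbolic bigx bigy). Qed.

Let a_concave j : (j.+2 <= d)%N -> a j * a j.+2 <= a j.+1 ^+ 2.
Proof. exact: (mixed_log_concave F_perm F_linear F_gt0 F_hyperbolic bigx bigy). Qed.

(** Multiplying the proportionality by [alpha^i beta^(d-k-i)] gives [a (k + i) = c * a i], and a
    log-concave sequence with such a period is geometric. *)
Lemma mixed_eq_of_wedge_proportional k : (1 <= k <= d - 1)%N ->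
  proportional (wedge (wpow alpha k) Omega) (wedge (wpow beta k) Omega) ->
  forall k' : nat, (1 <= k' <= d - 1)%N ->
    mixed I Omega alpha beta k' (d - k') ^+ 2 =
      mixed I Omega alpha beta (k' - 1) (d - k' + 1) *
      mixed I Omega alpha beta (k' + 1) (d - k' - 1).
Proof.
move=> kd [c [c0 cc]]; apply/mixed_equalities.
apply: (periodic_log_concave a_gt0 a_concave (c := c) kd) => i ik.
pose s := nseq i x ++ nseq (d - k - i) y.
have sk : (size s + k)%N = d by rewrite size_cat !size_nseq; lia.
have sH w : w \in map val s -> Hpp 1 w by exact: vals_Hpp.
have zk (z : form11 M) : size (s ++ nseq k z) = d by rewrite size_cat size_nseq.
have vals_cat (z : form11 M) : wprod (map val (s ++ nseq k z)) Omega =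
    wprod (map val s) (wedge (wpow (val z) k) Omega).
  by rewrite map_cat map_nseq wprod_cat wedge_wpow.
have E z := etrans (wprod_size (zk z)) (congr1 I (vals_cat z)).
have smooth (z : form11 M) :
    smooth_form n.*2 (wprod (map val s) (wedge (wpow (val z) k) Omega)).
  by rewrite -vals_cat; exact: smooth_wprod_vals dn Omega_Hpp _ (zk z).
have -> : a (k + i)%N = F (s ++ nseq k x).
  by apply: F_perm; rewrite nseqD -catA perm_catC subnDA.
have -> : a i = F (s ++ nseq k y).
  by rewrite /a /s -catA -nseqD; congr (F (_ ++ nseq _ _)); lia.
have smooth_c f : smooth_form n.*2 f -> smooth_form n.*2 (c *: f).
  move=> fs; rewrite -[c *: f]addr0.
  by apply: smooth_form_linear => //; exact: smooth_form0.
rewrite !E; case: I_integration => I_coh I_lin _.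
have I_scale f : smooth_form n.*2 f -> I (c *: f) = c * I f.
  (* Writing [c f] as [(c - 1) f + f] reads homogeneity off the linearity of [I]. *)
  move=> fs; have := I_lin (c - 1) f f fs fs.
  by rewrite scalerBl scale1r subrK mulrBl mul1r subrK.
rewrite -I_scale // -wprod_scale; apply: I_coh => //.
  by rewrite wprod_scale; exact: smooth_c.
exact: cohomologous_wprod.
Qed.

(** With common ratio [r] and [t^d = a 0], the binomial theorem sums the volume of [alpha + beta] to
    [(t r + t)^d], while [alpha] has volume [(t r)^d]. *)
Lemma geometric_mixed_volume :
  (forall k : nat, (1 <= k <= d - 1)%N ->
    mixed I Omega alpha beta k (d - k) ^+ 2 =
      mixed I Omega alpha beta (k - 1) (d - k + 1) *
      mixed I Omega alpha beta (k + 1) (d - k - 1)) ->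
  vol I d Omega (alpha + beta) `^ (d%:R^-1) =
    vol I d Omega alpha `^ (d%:R^-1) + vol I d Omega beta `^ (d%:R^-1).
Proof.
move=> /mixed_equalities eqs; have d0 : (0 < d)%N := ltnW d_gt1.
have geo := geometric_of_eq a_gt0 d0 eqs.
have : 0 <= a 1 / a 0 by rewrite divr_ge0 // ltW // a_gt0.
move: (a 1 / a 0) geo => r geo r0.
pose t := a 0 `^ (d%:R^-1); have t0 : 0 <= t by exact: powR_ge0.
have td : t ^+ d = a 0 by rewrite expn_powR_inv // ltW // a_gt0.
have -> : vol I d Omega (alpha + beta) = (t * r + t) ^+ d.
  rewrite -[alpha + beta]/(val (x + y)) vol_nseq (form_expand F_perm F_linear).
  rewrite addrC exprDn; apply: eq_bigr => j _; congr (_ *+ _).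
  have jd : (j <= d)%N by rewrite -ltnS.
  by rewrite -[LHS]/(a j) geo // -td exprMn mulrA -exprD subnK.
rewrite -ad geo // -td -exprMn -a0 -/t !powR_expn_inv //.
  exact: mulr_ge0.
by rewrite addr_ge0 // mulr_ge0.
Qed.

(** The d-th powers of both sides have binomial expansions with coefficients [a j] and
    [s^j t^(d-j)]. The former dominate, so equality of the sums forces equality termwise, and
    [t alpha - s beta] is then a null class. *)
Lemma proportional_of_volume :
  vol I d Omega (alpha + beta) `^ (d%:R^-1) =
    vol I d Omega alpha `^ (d%:R^-1) + vol I d Omega beta `^ (d%:R^-1) ->
  proportional alpha beta.
Proof.
have d0 : (0 < d)%N := ltnW d_gt1.
set s := vol I d Omega alpha `^ _; set t := vol I d Omega beta `^ _ => vol_eq.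
have s0 : 0 < s by exact: powR_gt0.
have t0 : 0 < t by exact: powR_gt0.
have sd : s ^+ d = a d by rewrite ad expn_powR_inv // ltW.
have td : t ^+ d = a 0 by rewrite a0 expn_powR_inv // ltW.
have ge := log_concave_ge_geometric a_gt0 a_concave s0 t0 sd td.
have vol_sum : vol I d Omega (alpha + beta) = \sum_(j < d.+1) a j *+ 'C(d, j).
  by rewrite -[alpha + beta]/(val (x + y)) vol_nseq (form_expand F_perm F_linear).
have geo j : (j <= d)%N -> a j = s ^+ j * t ^+ (d - j).
  move=> jd; apply/eqP; rewrite eq_le ge // andbT leNgt; apply/negP => lt.
  have vol_ge0 : 0 <= vol I d Omega (alpha + beta).
    rewrite vol_sum; apply: sumr_ge0 => i _; apply/mulrn_wge0/ltW/a_gt0.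
    by rewrite -ltnS.
  have : vol I d Omega (alpha + beta) = (t + s) ^+ d.
    by rewrite [t + s]addrC -vol_eq expn_powR_inv.
  rewrite vol_sum exprDn => /eqP; rewrite gt_eqF //.
  have jd' : (j < d.+1)%N by [].
  rewrite (bigD1 (Ordinal jd')) //= [ltRHS](bigD1 (Ordinal jd')) //=.
  apply: ltr_leD.
    by rewrite ltr_pMn2r ?bin_gt0 // mulrC.
  apply: ler_sum => i _; apply: ler_wMn2r.
  by rewrite mulrC ge // -ltnS.
(* A Kähler form, repeated [d - 2] times, provides the ample arguments at which nondegeneracy is
   invoked. *)
have [w0 w0_kahler] : exists w : diff_form M, kahler_form w by case: M_kahler.
have w0H : Hpp 1 w0 by case: w0_kahler.
pose w := Form11 (introT (closed11P _) w0H).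
have wA z : z \in nseq (d - 2) w -> ample11 z.
  move=> /nseqP[-> _]; split=> //; exists w0; split=> //.
  exact: chart_eq_cohomologous.
have sz : (size (nseq (d - 2) w)).+2 = d by rewrite size_nseq; lia.
have null := collinear_of_geometric F_perm F_linear F_gt0 F_hyperbolic bigx bigy geo.
have := intersection_nondegenerate I_integration dn Omega_Hpp Omega_lorentzian
  sz wA (fun z => null _ z sz wA).
(* Dividing the null class [t alpha - s beta] by [t] yields the factor [s / t]. *)
move=> /(cohomologous_scale t^-1)[k [th [ths thE]]].
exists (s / t); split; first by rewrite mulf_neq0 ?invr_neq0 // gt_eqF.
exists k, th; split=> // i p l ip; rewrite -thE //.
have E : val (t *: x - s *: y) i p l = t * alpha i p l - s * beta i p l by [].
rewrite -[RHS]/(t^-1 * val (t *: x - s *: y) i p l - t^-1 * 0) E mulr0 subr0.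
rewrite -[LHS]/(alpha i p l - s / t * beta i p l) mulrBr mulKf ?gt_eqF //.
by rewrite mulrA [t^-1 * s]mulrC.
Qed.

End Equivalences.

Theorem theorem2 (R : realType) (n d : nat) (X : topologicalType)
    (M : complex_manifold R n X) (I : diff_form M -> R)
    (Omega alpha beta : diff_form M)
    (M_kahler : compact_kahler M) (I_integration : integration I)
    (d_bounds : (2 <= d <= n - 2)%N)
    (Omega_lorentzian : strictly_lorentzian I d Omega)
    (alpha_nef : nef alpha) (beta_nef : nef beta)
    (alpha_big : 0 < vol I d Omega alpha)
    (beta_big : 0 < vol I d Omega beta) :
  [<-> proportional alpha beta;
       exists2 k : nat, (1 <= k <= d - 1)%N &
         proportional (wpow alpha k) (wpow beta k);
       exists2 k : nat, (1 <= k <= d - 1)%N &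
         proportional (wedge (wpow alpha k) Omega) (wedge (wpow beta k) Omega);
       forall k : nat, (1 <= k <= d - 1)%N ->
         mixed I Omega alpha beta k (d - k) ^+ 2 =
           mixed I Omega alpha beta (k - 1) (d - k + 1) *
           mixed I Omega alpha beta (k + 1) (d - k - 1);
       vol I d Omega (alpha + beta) `^ (d%:R^-1) =
         vol I d Omega alpha `^ (d%:R^-1) + vol I d Omega beta `^ (d%:R^-1)].
Proof.
have [d_gt1 dn2] := andP d_bounds.
have dn : (d <= n)%N by lia.
have [alpha_Hpp beta_Hpp] : Hpp 1 alpha /\ Hpp 1 beta.
  by case: alpha_nef; case: beta_nef.
pose x := Form11 (introT (closed11P alpha) alpha_Hpp).
pose y := Form11 (introT (closed11P beta) beta_Hpp).
have [smooth_Omega closed_Omega _] : Hpp (n - d) Omega by case: Omega_lorentzian.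
(* The equivalence unfolds to the cycle of implications from each condition to the next, the last
   one returning to the first. *)
split; [|split; [|split; [|split]]].
- move=> [c [c0 ab]]; exists 1%N; first by lia.
  by exists c; split=> //; rewrite /= !wedge_form1r.
- move=> [k kd [c [c0 ab]]]; exists k => //; exists c; split=> //.
  by rewrite -wedge_scalel; exact: cohomologous_wedgel smooth_Omega closed_Omega ab.
- move=> [k kd prop]; exact: (mixed_eq_of_wedge_proportional I_integration d_gt1 dn
    Omega_lorentzian (x := x) (y := y) alpha_nef beta_nef alpha_big beta_big kd prop).
- exact: (geometric_mixed_volume I_integration d_gt1 dn Omega_lorentzian
    (x := x) (y := y) alpha_nef beta_nef alpha_big beta_big).
- exact: (proportional_of_volume M_kahler I_integration d_gt1 dn Omega_lorentzian
    (x := x) (y := y) alpha_nef beta_nef alpha_big beta_big).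
Qed.
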